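(* Let $K\subseteq E\subseteq F\subseteq L$ be a tower of analytic fields such that the extension $L/K$ is small. Then $\mathrm{Tr.c}(F/E)\le \mathrm{Tr.c}(L/K)$; in particular, $F/E$ is small.
   Context: An analytic field is a field complete with respect to a real-valued (rank at most one, possibly trivial) multiplicative non-archimedean absolute value $|\ |$. An extension (or tower) of analytic fields is a field extension in which the absolute value of the larger field restricts to that of the smaller one. For a valued field $K$, $K^a$ denotes an algebraic closure with the extended absolute value, and $\widehat{\ \cdot\ }$ denotes completion. For an extension $L/K$ of analytic fields and a subset $S\subset L$, $\widehat{K(S)^a}$ denotes the closure in $\widehat{L^a}$ of the algebraic closure of $K(S)$. A set $S\subset L$ is topologically-algebraically (t.a.) generating for $L/K$ if $\widehat{L^a}=\widehat{K(S)^a}$. The topological generating degree $\mathrm{Tr.c}(L/K)$ is the minimum of the cardinalities of t.a. generating sets of $L/K$. The extension $L/K$ is called small if $\mathrm{Tr.c}(L/K)<\infty$ (i.e. it is finite). *)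

(* Defs.v *)
From HB Require Import structures.
From mathcomp Require Import all_boot all_order all_algebra.
From mathcomp Require Import all_classical all_reals topology.

Set Implicit Arguments.
Unset Strict Implicit.
Unset Printing Implicit Defensive.

Import Order.TTheory GRing.Theory Num.Theory.

Local Open Scope classical_set_scope.
Local Open Scope ring_scope.
Local Open Scope card_scope.

Lemma card_least (T : pointedType) (P : set (set T)) : P !=set0 ->
  exists2 S, P S & forall S', P S' -> S #<= S'.
Proof.
move=> [S0 PS0]; pose I := {S | P S}.
pose Q (G : set (I -> T)) := (forall f, G f -> forall i, (sval i) (f i)) /\
  (forall f g i, G f -> G g -> f i = g i -> f = g).
have [H HQ Htot|G [[Gin Ginj] Gmax]] := @Zorn_bigcup (I -> T) Q.
  split=> [f [X HX Xf]|f g i [X HX Xf] [Y HY Yg]].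
    by have [+ _] := HQ _ HX; apply.
  have [XY|YX] := Htot _ _ HX HY.
    by have [_] := HQ _ HY; apply=> //; exact: XY.
  by have [_] := HQ _ HX; apply=> //; exact: YX.
have [[i icov]|ncov] :=
    pselect (exists i : I, sval i `<=` (fun f => f i) @` G).
  exists (sval i); first exact: (svalP i).
  move=> S' PS'; pose j : I := exist _ S' PS'.
  apply: (card_le_trans (subset_card_le icov)).
  apply: (card_le_trans (card_image_le _ G)).
  have jinj : {in G &, injective (fun f : I -> T => f j)}.
    by move=> f g /set_mem Gf /set_mem Gg; exact: Ginj.
  have /card_eqPle[_ /card_le_trans] := inj_card_eq jinj; apply.
  apply: subset_card_le.
  by move=> _ [f Gf <-]; exact: (Gin _ Gf j).
have /choice[t tP] : forall i : I,
    exists x, (sval i) x /\ forall f, G f -> f i <> x.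
  move=> i; apply: contrapT => nx; apply: ncov; exists i => x ix.
  apply: contrapT => nGx; apply: nx; exists x; split=> // f Gf fx.
  by apply: nGx; exists f.
exfalso; apply: (Gmax (t |` G)).
  split=> [f|GT]; first by right.
  have [_ tn] := tP (exist _ S0 PS0).
  exact: (tn t (GT t (or_introl erefl))).
split=> [f [->|Gf] i|f g i [->|Gf] [->|Gg] //]; first by have [] := tP i.
- exact: Gin.
- by move=> tg; have [_ /(_ g Gg)] := tP i; rewrite tg.
- by move=> ft; have [_ /(_ f Gf)] := tP i.
- exact: Ginj.
Qed.

(* The norm of a [normedZmodType] satisfies [`|x *+ n| = `|x| *+ n], which is
   false for a non-archimedean absolute value; hence a separate [absv].
   The metric structure is forced by [absv] through [ball_absvE], so that
   [closure], [dense] and completeness below are those of the library. *)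
HB.mixin Record Field_isValued (R : realType) L
    of GRing.Field L & PseudoMetric R L := {
  absv : L -> R ;
  absv_ge0 : forall x, 0 <= absv x ;
  absv_eq0 : forall x, absv x = 0 <-> x = 0 ;
  absvM : forall x y, absv (x * y) = absv x * absv y ;
  absv_ultra : forall x y, absv (x + y) <= Num.max (absv x) (absv y) ;
  ball_absvE : forall (x : L) (e : R), ball x e = [set y | absv (x - y) < e]
}.

#[short(type="valuedFieldType")]
HB.structure Definition ValuedField (R : realType) :=
  { L of GRing.Field L & PseudoMetric R L & Field_isValued R L }.

#[short(type="analyticFieldType")]
HB.structure Definition AnalyticField (R : realType) :=
  { L of ValuedField R L & Complete L }.

Definition absv_preserving (R : realType) (K L : valuedFieldType R)
  (f : K -> L) : Prop := forall x, absv (f x) = absv x.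

(* A choice of [L^a] (an algebraic closure of [L] with an absolute value
   extending that of [L]) and of its completion. *)
Record completedClosure (R : realType) (L : analyticFieldType R) := {
  cc_alg : valuedFieldType R ;
  cc_compl :> analyticFieldType R ;
  cc_in : {rmorphism L -> cc_alg} ;
  cc_map : {rmorphism cc_alg -> cc_compl} ;
  cc_in_absv : absv_preserving cc_in ;
  cc_in_algebraic : forall x : cc_alg, algebraicOver cc_in x ;
  cc_alg_closed : GRing.closed_field_axiom cc_alg ;
  cc_map_absv : absv_preserving cc_map ;
  cc_map_dense : dense (range cc_map)
}.

Definition cc_embed (R : realType) (L : analyticFieldType R)
  (CL : completedClosure L) : {rmorphism L -> CL} :=
  [the {rmorphism L -> CL} of @cc_map _ _ CL \o @cc_in _ _ CL].

Section TopologicalGeneratingDegree.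
Variables (R : realType) (K L : analyticFieldType R) (i : K -> L).
Variable CL : completedClosure L.

(* [K(S)], as a subset of [L] *)
Definition adjoin_set (S : set L) : set L :=
  smallest [set A : set L | GRing.divring_closed [in A]] (range i `|` S).

(* the algebraic closure of [K(S)] inside the completion of [L^a] *)
Definition alg_closure_adjoin (S : set L) : set CL :=
  [set x | exists p : {poly L},
     [/\ p != 0, p \is a polyOver [in adjoin_set S]
       & root (map_poly (cc_embed CL) p) x]].

Definition ta_generating (S : set L) : Prop :=
  closure (alg_closure_adjoin S) = [set: CL].

Definition min_ta_generating (S : set L) : Prop :=
  ta_generating S /\ forall T : set L, ta_generating T -> S #<= T.

(* As the library has no type of cardinals, the cardinal [Tr.c(L/K)] is
   represented by a chosen t.a. generating set of least cardinality, and is to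
   be used only through [#<=] and [finite_set].  The default value [setT] of
   [xget] is irrelevant by [TrcP]. *)
Definition Trc : set L := xget setT min_ta_generating.

Lemma ta_generatingT : ta_generating setT.
Proof.
apply/seteqP; split=> // x _ B /nbhs_interior Bx.
have [|z [Bz [y _ yz]]] := @cc_map_dense _ _ CL (interior B) _ (open_interior B).
  by exists x; exact: nbhs_singleton.
exists z; split; last exact: interior_subset.
have [p p0 py] := @cc_in_algebraic _ _ CL y; exists p; split=> //.
  apply/allP => a _; apply/mem_set => A /= [_ AT].
  by apply: AT; right.
by rewrite -yz map_poly_comp /root horner_map fmorph_eq0.
Qed.

Lemma TrcP : min_ta_generating Trc.
Proof.
apply: xgetPex.
have [|S] := @card_least L ta_generating.
  by exists setT; exact: ta_generatingT.
by exists S.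
Qed.

Definition small : Prop := finite_set Trc.

End TopologicalGeneratingDegree.

(* Main.v *)
(* Everything takes place in an algebraically closed valued field W containing
   L, where x denotes a finite t.a. generating set of L/K, with n elements.

   F is countably t.a. generated over E.  Choose a countable subset Y of F such
   that, for each i, x_i is as far from the algebraic closure of
   E(Y, x_1, ..., x_(i-1)) as from that of F(x_1, ..., x_(i-1)).  If A is
   contained in A', A' in the closure of A(x)^a, and dist(x, A) = dist(x, A'),
   then x can be specialised to points of A without changing the values of given
   polynomials over A' much; so every element of A', being a limit of algebraic
   functions of x, is a limit of elements of A.  Descending induction on i then
   gives F in the closure of E(Y)^a.

   For g in F the n-tuples v in F^n such that E(v)^a meets a given neighbourhood
   of g form an open set by continuity of roots.  It is also dense: (g, v) is
   close to a tuple of elements of E(x)^a, which satisfies a relation P = 0.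
   Project (g, v) along a line, replacing v_i by w_i = v_i - c_i g.  If the
   slopes c_i are generic, P has a zero on that line about as close to (g, v) as
   its zeros anywhere, and if c_i lies in E(w), the first coordinate of this
   zero is algebraic over E(w).  Slopes of the form c_i = sum_s b_s w_i^s with
   binary digits b_s are generic enough even if E is finite or trivially
   valued; w_i is then a fixed point of a contraction.  Hence, as in Baire's
   theorem, some w in F^n is good for all elements of Y at once.

   If F is trivially valued, it embeds in the residue field of W and lifting
   shows that its transcendence degree over E is at most n. *)

Require Import Defs.
From HB Require Import structures.
From mathcomp Require Import all_boot all_order all_algebra.
From mathcomp Require Import all_classical all_reals topology.
From mathcomp Require Import ring lra zify.

Set Implicit Arguments.
Unset Strict Implicit.
Unset Printing Implicit Defensive.

Import Order.TTheory GRing.Theory Num.Theory.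

Local Open Scope classical_set_scope.
Local Open Scope ring_scope.
Local Open Scope card_scope.

(** * Fields generated by sets and their algebraic closures *)

Definition subfield (F : fieldType) (A : set F) : Prop :=
  [/\ A 1, forall x y, A x -> A y -> A (x - y)
    & forall x y, A x -> A y -> A (x / y)].

Lemma subfieldE (F : fieldType) (A : set F) :
  GRing.divring_closed [in A] <-> subfield A.
Proof.
split=> [[A1 AB AV]|[A1 AB AV]]; split.
- by have := A1; rewrite inE.
- by move=> x y Ax Ay; have := AB x y; rewrite !inE; apply.
- by move=> x y Ax Ay; have := AV x y; rewrite !inE; apply.
- by rewrite inE.
- by move=> x y; rewrite !inE; apply: AB.
- by move=> x y; rewrite !inE; apply: AV.
Qed.

Definition over (F : nzRingType) (A : set F) (p : {poly F}) : Prop :=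
  forall i, A p`_i.

Section SubfieldType.
Variables (F : fieldType) (A : set F) (Asub : subfield A).

(** The proof that [A] is a subfield is an argument of the predicate, so that the instance below,
    which depends on this proof, can be inferred from the predicate. *)
Definition subf_pred := fun _ : subfield A => [pred x | x \in A].
Let P := subf_pred Asub.

Fact subf_divring_closed : GRing.divring_closed P.
Proof. exact/subfieldE. Qed.

HB.instance Definition _ :=
  GRing.isDivringClosed.Build F (subf_pred Asub) subf_divring_closed.

(** A subfield given as a set becomes a field type, to which the theorems on [algebraicOver] and
    integral elements apply. *)
Record subf := Subf { subf_val : F ; subf_valP : subf_val \in P }.

HB.instance Definition _ := [isSub for subf_val].
HB.instance Definition _ := [Choice of subf by <:].
HB.instance Definition _ := [SubChoice_isSubIntegralDomain of subf by <:].
HB.instance Definition _ := [SubIntegralDomain_isSubField of subf by <:].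

Lemma subf_polyP (p : {poly F}) :
  over A p -> exists q : {poly subf}, p = map_poly subf_val q.
Proof.
move=> pA; have pA' i : p`_i \in P by rewrite !inE; apply: pA.
pose q := \poly_(i < size p) (Subf (pA' i)).
exists q; apply/polyP => i; rewrite coef_map_id0 // coef_poly.
by case: ltnP => // /leq_sizeP/(_ _ (leqnn _)) ->.
Qed.

Lemma map_subf_over (q : {poly subf}) : over A (map_poly subf_val q).
Proof.
by move=> i; rewrite coef_map_id0 //; have := subf_valP q`_i; rewrite !inE.
Qed.

Lemma algebraicOverE x : algebraicOver subf_val x <->
  exists p : {poly F}, [/\ p != 0, over A p & root p x].
Proof.
split=> [[q q0 qx]|[p [p0 pA px]]].
  exists (map_poly subf_val q); split=> //; last exact: map_subf_over.
  by rewrite (map_poly_eq0 (\val : {rmorphism subf -> F})).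
have [q pq] := subf_polyP pA; exists q; last by rewrite -pq.
by move: p0; rewrite pq (map_poly_eq0 (\val : {rmorphism subf -> F})).
Qed.

End SubfieldType.

Definition alg (F : fieldType) (A : set F) : set F :=
  [set x | exists p : {poly F}, [/\ p != 0, over A p & root p x]].

Definition gen (F : fieldType) (S : set F) : set F := smallest (@subfield F) S.

(** The closure operator of algebraic dependence, purely algebraic; [ac] below is its topological
    closure. *)
Definition cl (F : fieldType) (S : set F) : set F := alg (gen S).

Section Algebraic.
Variable F : fieldType.
Implicit Types A B S T : set F.

Lemma subfield0 A : subfield A -> A 0.
Proof. by move=> [A1 AB _]; rewrite -(subrr 1); exact: AB. Qed.

Lemma subfieldB A x y : subfield A -> A x -> A y -> A (x - y).
Proof. by move=> [_ AB _]; exact: AB. Qed.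

Lemma subfieldN A x : subfield A -> A x -> A (- x).
Proof. by move=> sA Ax; rewrite -sub0r; apply: subfieldB => //; exact: subfield0. Qed.

Lemma subfieldD A x y : subfield A -> A x -> A y -> A (x + y).
Proof. by move=> sA Ax Ay; rewrite -(opprK y); apply: subfieldB => //; exact: subfieldN. Qed.

Lemma subfieldV A x : subfield A -> A x -> A x^-1.
Proof. by move=> [A1 _ AV] Ax; rewrite -div1r; exact: AV. Qed.

Lemma subfieldM A x y : subfield A -> A x -> A y -> A (x * y).
Proof.
by move=> sA Ax Ay; rewrite -(invrK y); have [_ _ AV] := sA; apply: AV => //; exact: subfieldV.
Qed.

Lemma subfieldX A x n : subfield A -> A x -> A (x ^+ n).
Proof.
move=> sA Ax; elim: n => [|n IH]; first by case: sA.
by rewrite exprS; exact: subfieldM.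
Qed.

Lemma alg_incl A : subfield A -> A `<=` alg A.
Proof.
move=> sA x Ax; exists ('X - x%:P); split; rewrite ?polyXsubC_eq0 //.
  move=> i; rewrite coefB coefX coefC; apply: subfieldB => //.
    by case: (i == 1)%N; [case: sA|exact: subfield0].
  by case: (i == 0)%N => //; exact: subfield0.
by rewrite root_XsubC.
Qed.

Lemma alg_mono A B : A `<=` B -> alg A `<=` alg B.
Proof.
by move=> AB x [p [p0 pA px]]; exists p; split=> // i; exact/AB/pA.
Qed.

Lemma alg_subfield A : subfield A -> subfield (alg A).
Proof.
move=> sA; split.
- by apply: alg_incl => //; case: sA.
- move=> x y /(algebraicOverE sA) Ax /(algebraicOverE sA) Ay.
  apply/(algebraicOverE sA).
  exact: (@algebraic_sub _ _ (\val : {rmorphism (subf sA) -> F})).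
- move=> x y /(algebraicOverE sA) Ax /(algebraicOverE sA) Ay.
  apply/(algebraicOverE sA).
  exact: (@algebraic_div _ _ (\val : {rmorphism (subf sA) -> F})).
Qed.

Lemma alg_monic A x : subfield A -> alg A x ->
  exists p : {poly F}, [/\ p \is monic, over A p & root p x].
Proof.
move=> sA [p [p0 pA px]]; exists ((lead_coef p)^-1 *: p); split.
- by rewrite monicE lead_coefZ mulVf ?lead_coef_eq0.
- move=> i; rewrite coefZ mulrC; case: sA => _ _; apply; exact: pA.
- by rewrite /root hornerZ (rootP px) mulr0.
Qed.

(** A root of a monic polynomial whose coefficients are integral over [A] is integral over [A], and
    over a field integral means algebraic. *)
Lemma alg_idem A : subfield A -> alg (alg A) `<=` alg A.
Proof.
move=> sA x /(alg_monic (alg_subfield sA))[p [pm pA px]].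
pose f := (\val : {rmorphism (subf sA) -> F}).
apply/(algebraicOverE sA)/(integral_algebraic f).
apply: (integral_root_monic pm px) => a /(nthP 0)[i _ <-].
apply/(integral_algebraic f)/(algebraicOverE sA); exact: pA.
Qed.

Lemma gen_subfield S : subfield (gen S).
Proof.
split; first by move=> A [[]].
- move=> x y Sx Sy A AS; have [[_ AB _] _] := AS.
  by apply: AB; [exact: Sx|exact: Sy].
- move=> x y Sx Sy A AS; have [[_ _ AV] _] := AS.
  by apply: AV; [exact: Sx|exact: Sy].
Qed.

Lemma gen_incl S : S `<=` gen S. Proof. exact: sub_gen_smallest. Qed.

Lemma gen_min S A : subfield A -> S `<=` A -> gen S `<=` A.
Proof. by move=> sA SA; exact: smallest_sub. Qed.

Lemma gen_mono S T : S `<=` T -> gen S `<=` gen T.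
Proof.
by move=> ST; apply: gen_min (gen_subfield T) _ => x /ST; exact: gen_incl.
Qed.

Lemma cl_subfield S : subfield (cl S).
Proof. by apply: alg_subfield; exact: gen_subfield. Qed.

Lemma gen_cl S : gen S `<=` cl S.
Proof. by apply: alg_incl; exact: gen_subfield. Qed.

Lemma cl_incl S : S `<=` cl S.
Proof. by move=> x /gen_incl; exact: gen_cl. Qed.

Lemma cl_mono S T : S `<=` T -> cl S `<=` cl T.
Proof. by move=> /gen_mono; exact: alg_mono. Qed.

Lemma cl_min S A : subfield A -> alg A `<=` A -> S `<=` A -> cl S `<=` A.
Proof. by move=> sA aA SA x /(alg_mono (gen_min sA SA))/aA. Qed.

Lemma cl_alg S : alg (cl S) `<=` cl S.
Proof. by apply: alg_idem; exact: gen_subfield. Qed.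

Lemma cl_sub S T : S `<=` cl T -> cl S `<=` cl T.
Proof. by apply: cl_min; [exact: cl_subfield|exact: cl_alg]. Qed.

End Algebraic.

(** * The exchange property *)

Definition subring (F : nzRingType) (D : set F) : Prop :=
  [/\ D 1, forall x y, D x -> D y -> D (x - y)
    & forall x y, D x -> D y -> D (x * y)].

Section Subring.
Variables (F : nzRingType) (D : set F).
Hypothesis sD : subring D.

Lemma subring0 : D 0.
Proof. by have [D1 DB _] := sD; rewrite -(subrr 1); exact: DB. Qed.

Lemma subringD x y : D x -> D y -> D (x + y).
Proof.
move=> Dx Dy; have [D1 DB _] := sD; rewrite -(opprK y) -[- y]sub0r.
by apply: (DB) => //; apply: (DB) => //; exact: subring0.
Qed.

Lemma subringM x y : D x -> D y -> D (x * y).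
Proof. by have [_ _] := sD; apply. Qed.

Lemma subring_sum (I : Type) (r : seq I) (P : pred I) f :
  (forall i, P i -> D (f i)) -> D (\sum_(i <- r | P i) f i).
Proof.
by move=> fD; apply: big_ind => [|x y|//]; [exact: subring0|exact: subringD].
Qed.

Lemma subringX x n : D x -> D (x ^+ n).
Proof.
move=> Dx; elim: n => [|n IH]; first by case: sD.
by rewrite exprS; exact: subringM.
Qed.

Lemma overC c : D c -> over D c%:P.
Proof. by move=> Dc i; rewrite coefC; case: eqP => // _; exact: subring0. Qed.

Lemma overX : over D 'X.
Proof. by move=> i; rewrite coefX; case: eqP => // _; [case: sD|exact: subring0]. Qed.

Lemma over_subring : subring (over D).
Proof.
split; first by apply: overC; case: sD.
- move=> p q pD qD i; rewrite coefB; have [_ DB _] := sD; exact: DB.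
- move=> p q pD qD i; rewrite coefM; apply: subring_sum => j _; exact: subringM.
Qed.

Lemma subring_horner (p : {poly F}) x : over D p -> D x -> D p.[x].
Proof.
move=> pD Dx; rewrite horner_coef; apply: subring_sum => i _.
by apply: subringM => //; exact: subringX.
Qed.

End Subring.

Lemma over_comp (F : nzRingType) (D : set F) (p q : {poly F}) : subring D ->
  over D p -> over D q -> over D (p \Po q).
Proof.
move=> sD pD qD; have sO := over_subring sD; rewrite comp_polyE.
apply: (subring_sum sO) => i _; rewrite -mul_polyC; apply: (subringM sO).
  exact: overC.
exact: (subringX sO).
Qed.

Lemma over_sub (F : nzRingType) (D D' : set F) p : D `<=` D' -> over D p -> over D' p.
Proof. by move=> DD' pD i; exact: DD'. Qed.

Lemma subfield_subring (F : fieldType) (A : set F) : subfield A -> subring A.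
Proof. by move=> sA; split=> [|x y|x y]; [case: sA|exact: subfieldB|exact: subfieldM]. Qed.

Section Exchange.
Variable F : fieldType.
Implicit Types A B D S T : set F.

Definition fractions D : set F :=
  [set q | exists a b, [/\ D a, D b, b != 0 & q = a / b]].

Lemma fractions_subfield D : subring D -> subfield (fractions D).
Proof.
move=> sD; have D0 := subring0 sD; have [D1 DB DM] := sD; split.
- by exists 1, 1; rewrite oner_eq0 divr1.
- move=> _ _ [a [b [Da Db b0 ->]]] [c [d [Dc Dd d0 ->]]].
  exists (a * d - c * b), (b * d); split; rewrite ?mulf_neq0 //.
  + by apply: DB; exact: DM.
  + exact: DM.
  + by rewrite -mulNr addf_div // mulNr.
- move=> _ _ [a [b [Da Db b0 ->]]] [c [d [Dc Dd d0 ->]]].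
  have [->|c0] := eqVneq c 0.
    by exists 0, 1; rewrite oner_eq0 mul0r invr0 mulr0 mul0r.
  exists (a * d), (b * c); split; rewrite ?mulf_neq0 //; try exact: DM.
  by rewrite invf_div mulf_div.
Qed.

Lemma fractions_incl D : subring D -> D `<=` fractions D.
Proof. by move=> [D1 _ _] x Dx; exists x, 1; rewrite oner_eq0 divr1. Qed.

Lemma clear_denominators D (p : {poly F}) : subring D ->
  over (fractions D) p -> exists2 c, D c /\ c != 0 & over D (c *: p).
Proof.
move=> sD; have D0 := subring0 sD; have [D1 DB DM] := sD.
elim/poly_ind: p => [|p a IH] pD.
  by exists 1; [rewrite oner_eq0|move=> i; rewrite scaler0 coef0].
have [c [Dc c0] cp] : exists2 c, D c /\ c != 0 & over D (c *: p).
  by apply: IH => i; have := pD i.+1; rewrite coefD coefMX coefC /= addr0.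
have [u [v [Du Dv v0 av]]] : fractions D a.
  by have := pD 0%N; rewrite coefD coefMX coefC /= add0r.
exists (c * v); first by split; [exact: DM|rewrite mulf_neq0].
move=> i; rewrite coefZ coefD coefMX coefC; case: i => [|i] /=.
  by rewrite add0r av mulrACA divff // mulr1; exact: DM.
by rewrite addr0 mulrAC -coefZ; exact: DM.
Qed.

(** The ring A[x]. *)
Definition horners A x : set F := [set q.[x] | q in over A].

Lemma horners_subring A x : subfield A -> subring (horners A x).
Proof.
move=> /subfield_subring/over_subring[O1 OB OM]; split.
- by exists 1; rewrite ?hornerE.
- by move=> _ _ [p pA <-] [q qA <-]; exists (p - q); rewrite ?hornerE //; exact: OB.
- by move=> _ _ [p pA <-] [q qA <-]; exists (p * q); rewrite ?hornerE //; exact: OM.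
Qed.

Lemma gen_adjoin A x : subfield A -> gen (A `|` [set x]) `<=` fractions (horners A x).
Proof.
move=> sA; have sA' := subfield_subring sA.
apply: gen_min; first exact/fractions_subfield/horners_subring.
move=> y Ay; apply: fractions_incl; first exact: horners_subring.
case: Ay => [Ay|->].
  by exists y%:P; [exact: (overC sA')|rewrite hornerC].
by exists 'X; [exact: (overX sA')|rewrite hornerX].
Qed.

Lemma gen_genU S T : gen (S `|` T) = gen (gen S `|` T).
Proof.
apply/seteqP; split; first by apply: gen_mono => x [Sx|Tx]; [left; exact: gen_incl|right].
apply: gen_min; first exact: gen_subfield.
move=> x [|Tx]; first by apply: gen_mono; left.
by apply: gen_incl; right.
Qed.

(** Clearing denominators turns an equation over A(x) into one over A[x], that is, into a bivariate
    [P] over [A] in which [x] can later be replaced by other points. *)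
Lemma cl_adjoin A x b : subfield A -> cl (A `|` [set x]) b ->
  exists P : {poly {poly F}}, [/\ forall i, over A P`_i,
    map_poly (horner_eval x) P != 0 & root (map_poly (horner_eval x) P) b].
Proof.
move=> sA [p [p0 pA pb]].
have [c [_ c0] cp] : exists2 c, horners A x c /\ c != 0 & over (horners A x) (c *: p).
  apply: clear_denominators; first exact: horners_subring.
  by move=> i; apply: gen_adjoin => //; exact: pA.
have /choice[q qP] : forall i, exists q, over A q /\ q.[x] = (c *: p)`_i.
  by move=> i; have [q qA qx] := cp i; exists q.
have mP : map_poly (horner_eval x) (\poly_(i < size p) q i) = c *: p.
  apply/polyP => i; rewrite coef_map_id0 /horner_eval ?horner0 // coef_poly.
  case: ltnP => [_|ip]; first by have [] := qP i.
  by rewrite horner0 coefZ nth_default ?mulr0.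
exists (\poly_(i < size p) q i); rewrite mP; split.
- move=> i j; rewrite coef_poly; case: ifP => _; first by have [] := qP i.
  by rewrite coef0; exact: subfield0.
- by rewrite scaler_eq0 negb_or c0.
- by rewrite /root hornerZ (rootP pb) mulr0.
Qed.

(** The relation [P] between [a] and [b] is read as an equation for [a] with coefficients evaluated
    at [b]. It is not identically zero: otherwise a nonzero coefficient of [Q], a polynomial over
    [gen S], would have the root [b]. *)
Lemma cl_exchange S a b : cl (S `|` [set a]) b -> ~ cl S b -> cl (S `|` [set b]) a.
Proof.
move=> Sab nSb; have sS := gen_subfield S.
have [P [PS P0 Pb]] : exists P : {poly {poly F}}, [/\ forall i, over (gen S) P`_i,
    map_poly (horner_eval a) P != 0 & root (map_poly (horner_eval a) P) b].
  by apply: cl_adjoin => //; rewrite /cl -gen_genU.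
pose Q := swapXY P; exists (map_poly (horner_eval b) Q); split.
- apply: contra_neq P0 => Q0; apply/polyP => i.
  rewrite coef0 coef_map_id0 /horner_eval ?horner0 //.
  suff -> : P`_i = 0 by rewrite horner0.
  apply/polyP => j; rewrite coef0 -coef_swapXY.
  have [//|Qj0] := eqVneq Q`_j 0; first by rewrite -/Q => ->; rewrite coef0.
  exfalso; apply: nSb; exists Q`_j; split=> //.
    by move=> k; rewrite coef_swapXY; exact: PS.
  have /(congr1 (fun r : {poly F} => r`_j)) := Q0.
  by rewrite coef0 coef_map_id0 /horner_eval ?horner0 // => /eqP.
- move=> i; rewrite coef_map_id0 /horner_eval ?horner0 //.
  apply: (@subring_horner _ (gen (S `|` [set b]))).
    exact/subfield_subring/gen_subfield.
    move=> j; rewrite coef_swapXY; have := PS j i; apply: gen_mono.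
    by move=> x; left.
  by apply: gen_incl; right.
- move: Pb; rewrite -!horner_swapXY swapXYK /root.
  by rewrite horner2_swapXY.
Qed.

Definition lset (s : seq F) : set F := [set` s].

(** Induction on [ys]: its first element is moved into [S] in exchange for one entry of [xs]. *)
Lemma steinitz xs ys S :
  (forall y, y \in ys -> cl (S `|` lset xs) y) ->
  (forall j, (j < size ys)%N -> ~ cl (S `|` lset (take j ys)) ys`_j) ->
  (size ys <= size xs)%N.
Proof.
elim: ys xs S => [//|y ys IH] xs S ysx ind.
have ny : ~ cl S y.
  have := ind 0%N isT; rewrite take0 /= => ny Sy; apply: ny.
  by apply: cl_mono Sy => x; left.
(* The entry of [xs] to be exchanged is the one at which [y] becomes dependent on a prefix of
   [xs]. *)
have [i ix [ci nci]] : exists2 i, (i < size xs)%N &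
    cl (S `|` lset (take i.+1 xs)) y /\ ~ cl (S `|` lset (take i xs)) y.
  apply: contrapT => nex.
  suff nc k : (k <= size xs)%N -> ~ cl (S `|` lset (take k xs)) y.
    by apply: (nc (size xs)) => //; rewrite take_size; apply: ysx; rewrite mem_head.
  elim: k => [_|k IHk kx].
    by rewrite take0 => cy; apply: ny; apply: cl_mono cy => x [].
  move=> cy; apply: nex; exists k => //; split=> //.
  by apply: IHk; exact: ltnW.
pose xs' := take i xs ++ drop i.+1 xs.
have szx : size xs = (size xs').+1.
  by rewrite size_cat size_takel 1?ltnW // size_drop -addSn subnKC.
have clx : cl (S `|` [set y] `|` lset (take i xs)) xs`_i.
  rewrite -setUA [[set y] `|` _]setUC setUA; apply: cl_exchange nci.
  apply: cl_mono ci => z [Sz|]; first by do 2!left.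
  rewrite /lset /= (take_nth 0 ix) mem_rcons inE => /orP[/eqP->|zx]; first by right.
  by left; right.
have sub : cl (S `|` lset xs) `<=` cl (S `|` [set y] `|` lset xs').
  apply: cl_sub => z [Sz|]; first by apply: cl_incl; do 2!left.
  rewrite /lset /= -[xs](cat_take_drop i) mem_cat (drop_nth 0) // inE.
  move=> /or3P[zx|/eqP->|zx].
  - by apply: cl_incl; right; rewrite /lset /= mem_cat zx.
  - apply: cl_mono clx => u [|ux]; first by left.
    by right; rewrite /lset /= mem_cat; apply/orP; left.
  - by apply: cl_incl; right; rewrite /lset /= mem_cat zx orbT.
rewrite szx ltnS; apply: IH (S `|` [set y]) _ _.
  by move=> z zys; apply/sub/ysx; rewrite inE zys orbT.
move=> j jy cy; apply: (ind j.+1) => //=.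
apply: cl_mono cy => z [[Sz|->]|zy]; first by left.
  by right; rewrite /lset /= mem_head.
by right; rewrite /lset /= inE; apply/orP; right.
Qed.

End Exchange.

(** * Absolute values and roots *)

Section AbsoluteValue.
Variables (R : realType) (F : valuedFieldType R).
Implicit Types x y z : F.

Lemma absv0 : absv (0 : F) = 0. Proof. exact/absv_eq0. Qed.

Lemma absv_eq0b x : (absv x == 0) = (x == 0).
Proof. by apply/eqP/eqP => /absv_eq0. Qed.

Lemma absv_gt0 x : (0 < absv x) = (x != 0).
Proof. by rewrite lt_def absv_eq0b absv_ge0 andbT. Qed.

Lemma absv1 : absv (1 : F) = 1.
Proof.
have /eqP := absvM (1 : F) 1.
rewrite mulr1 -subr_eq0 -{1}[absv 1]mulr1 -mulrBr mulf_eq0 absv_eq0b oner_eq0 /=.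
by rewrite subr_eq0 => /eqP.
Qed.

Lemma absvX x n : absv (x ^+ n) = absv x ^+ n.
Proof. by elim: n => [|n IH]; rewrite ?absv1 // !exprS absvM IH. Qed.

Lemma absvN x : absv (- x) = absv x.
Proof.
have : absv (-1 : F) ^+ 2 = 1 by rewrite -absvX sqrrN expr1n absv1.
move/eqP; rewrite sqrf_eq1 => /orP[/eqP h|/eqP h].
  by rewrite -mulN1r absvM h mul1r.
by have := absv_ge0 (-1 : F); rewrite h oppr_ge0 ler10.
Qed.

Lemma absvB x y : absv (x - y) = absv (y - x).
Proof. by rewrite -opprB absvN. Qed.

Lemma absvV x : absv x^-1 = (absv x)^-1.
Proof.
have [->|x0] := eqVneq x 0; first by rewrite invr0 absv0 invr0.
apply: (mulfI (_ : absv x != 0)); first by rewrite absv_eq0b.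
by rewrite -absvM !divff ?absv1 // absv_eq0b.
Qed.

Lemma absv_le x y r : absv x <= r -> absv y <= r -> absv (x + y) <= r.
Proof. by move=> xr yr; apply: le_trans (absv_ultra x y) _; rewrite ge_max xr. Qed.

Lemma absv_lt x y r : absv x < r -> absv y < r -> absv (x + y) < r.
Proof. by move=> xr yr; apply: le_lt_trans (absv_ultra x y) _; rewrite gt_max xr. Qed.

Lemma absv_leB x y r : absv x <= r -> absv y <= r -> absv (x - y) <= r.
Proof. by move=> xr yr; apply: absv_le; rewrite ?absvN. Qed.

Lemma absv_ltB x y r : absv x < r -> absv y < r -> absv (x - y) < r.
Proof. by move=> xr yr; apply: absv_lt; rewrite ?absvN. Qed.

Lemma absv_le_trans y x z r : absv (x - y) <= r -> absv (y - z) <= r -> absv (x - z) <= r.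
Proof. by move=> xy yz; rewrite -(subrKA y); exact: absv_le. Qed.

Lemma absv_lt_trans y x z r : absv (x - y) < r -> absv (y - z) < r -> absv (x - z) < r.
Proof. by move=> xy yz; rewrite -(subrKA y); exact: absv_lt. Qed.

Lemma absv_eql x y : absv y < absv x -> absv (x + y) = absv x.
Proof.
move=> yx; apply/eqP; rewrite eq_le absv_le ?(ltW yx) //= leNgt.
apply/negP => xyx; have := absv_ltB xyx yx.
by rewrite addrK ltxx.
Qed.

Lemma absv_sum_le (I : Type) (r : seq I) (P : pred I) (f : I -> F) M : 0 <= M ->
  (forall i, P i -> absv (f i) <= M) -> absv (\sum_(i <- r | P i) f i) <= M.
Proof.
move=> M0 fM; elim/big_ind : _ => [|x y|//]; first by rewrite absv0.
exact: absv_le.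
Qed.

Lemma absv_sum_lt (I : Type) (r : seq I) (P : pred I) (f : I -> F) M : 0 < M ->
  (forall i, P i -> absv (f i) < M) -> absv (\sum_(i <- r | P i) f i) < M.
Proof.
move=> M0 fM; elim/big_ind : _ => [|x y|//]; first by rewrite absv0.
exact: absv_lt.
Qed.

Lemma absv_prod (I : Type) (r : seq I) (P : pred I) (f : I -> F) :
  absv (\prod_(i <- r | P i) f i) = \prod_(i <- r | P i) absv (f i).
Proof. by apply: (big_morph _ absvM absv1). Qed.

End AbsoluteValue.

Lemma closed_field_split (F : fieldType) (p : {poly F}) :
  GRing.closed_field_axiom F -> p != 0 ->
  exists rs, p = lead_coef p *: \prod_(r <- rs) ('X - r%:P).
Proof.
move=> cF; have [n] := ubnP (size p); elim: n p => // n IH p pn p0.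
have [sp|sp] := leqP (size p) 1.
  exists [::]; rewrite big_nil alg_polyC [p in LHS]size1_polyC //.
  by rewrite [p in RHS]size1_polyC // lead_coefC.
(* The axiom solves [x ^+ n = \sum_(i < n) P i * x ^+ i]; with these [P i] the solution is a root of
   [p]. *)
have [x] := cF (size p).-1 (fun i => - (p`_i / lead_coef p)) (ltac:(by rewrite -subn1 subn_gt0)).
move=> xE; have px : root p x.
  apply/eqP; rewrite horner_coef -(ltn_predK sp) big_ord_recr /= -/(lead_coef p) xE.
  rewrite mulr_sumr -big_split big1 // => i _ /=.
  by rewrite mulNr mulrN mulrA [_ * (_ / _)]mulrC divfK ?lead_coef_eq0 // subrr.
have /factor_theorem[q pq] := px.
have q0 : q != 0 by apply: contra_neq p0 => q0; rewrite pq q0 mul0r.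
have [|//|rs qE] := IH q.
  by move: pn; rewrite pq size_Mmonic ?monicXsubC // size_XsubC addn2.
exists (x :: rs); rewrite big_cons pq lead_coefM lead_coefXsubC mulr1 {1}qE.
by rewrite mulrC scalerAr.
Qed.

Section Roots.
Variables (R : realType) (F : valuedFieldType R) (cF : GRing.closed_field_axiom F).
Implicit Types (p q : {poly F}) (e : R).

Lemma monic_split p : p \is monic -> exists rs, p = \prod_(r <- rs) ('X - r%:P).
Proof.
move=> pm; have [rs ->] := closed_field_split cF (monic_neq0 pm).
by exists rs; rewrite (monicP pm) scale1r.
Qed.

Lemma prod_ge (rs : seq F) (f : F -> R) e : 0 <= e ->
  (forall r, r \in rs -> e <= f r) -> e ^+ size rs <= \prod_(r <- rs) f r.
Proof.
move=> e0; elim: rs => [|r rs IH] fe; first by rewrite big_nil.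
rewrite big_cons exprS ler_pM ?exprn_ge0 //; first by apply: fe; rewrite mem_head.
by apply: IH => s srs; apply: fe; rewrite inE srs orbT.
Qed.

Lemma root_near p a e : p \is monic -> (1 < size p)%N -> 0 <= e ->
  absv p.[a] < e ^+ (size p).-1 -> exists2 r, root p r & absv (a - r) < e.
Proof.
move=> pm sp e0 pa; have [rs prs] := monic_split pm.
apply: contrapT => nr; move: pa; apply/negP; rewrite -leNgt.
rewrite prs size_prod_XsubC horner_prod absv_prod; apply: prod_ge => // r rrs.
rewrite hornerXsubC leNgt; apply/negP => ar; apply: nr; exists r => //.
by rewrite prs root_prod_XsubC.
Qed.

(** Half of the Newton polygon criterion. If all roots have absolute value at least [e], multiplying
    the factors one by one shows that no coefficient, scaled by [e ^+ i], exceeds the constant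
    one. *)
Lemma newton_root q e i : (0 < i)%N -> 0 < e -> absv q`_0 < absv q`_i * e ^+ i ->
  exists2 r, root q r & absv r < e.
Proof.
move=> i0 e0 qi; have q0 : q != 0.
  by apply: contraTneq qi => ->; rewrite !coef0 absv0 mul0r ltxx.
have [rs qrs] := closed_field_split cF q0.
apply: contrapT => nr; move: qi; apply/negP; rewrite -leNgt.
have {}nr r : r \in rs -> e <= absv r.
  move=> rrs; rewrite leNgt; apply/negP => re; apply: nr; exists r => //.
  by rewrite qrs rootZ ?lead_coef_eq0 // root_prod_XsubC.
rewrite qrs !coefZ !absvM -mulrA ler_wpM2l ?absv_ge0 //.
elim: rs nr i {i0 q q0 qrs} => [|r rs IH] rse i.
  rewrite big_nil !coef1; case: i => [|i]; first by rewrite mulr1.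
  by rewrite absv0 mul0r absv_ge0.
have {}IH j : absv (\prod_(s <- rs) ('X - s%:P))`_j * e ^+ j <= absv (\prod_(s <- rs) ('X - s%:P))`_0.
  by apply: IH => s srs; apply: rse; rewrite inE srs orbT.
have re : e <= absv r by apply: rse; rewrite mem_head.
rewrite big_cons mulrBl !coefB !coefXM !coefCM /= sub0r absvN absvM.
rewrite -[X in X * e ^+ i]ger0_norm ?absv_ge0 // ger0_norm ?absv_ge0 //.
rewrite -ler_pdivlMr ?exprn_gt0 //; apply: absv_leB; last first.
  by rewrite absvM ler_pdivlMr ?exprn_gt0 // -mulrA ler_wpM2l ?absv_ge0.
case: i => [|i] /=; first by rewrite absv0 expr0 divr1 mulr_ge0 ?absv_ge0.
rewrite ler_pdivlMr ?exprn_gt0 // exprSr mulrA mulrC.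
by apply: ler_pM => //; [exact: ltW|rewrite mulr_ge0 ?absv_ge0 // exprn_ge0 // ltW].
Qed.

(** The converse half: otherwise all terms at [r] would be smaller than the constant one, and their
    sum could not vanish. Together the two halves turn the existence of a small root into an
    inequality between coefficients, which survives perturbation. *)
Lemma newton_coef q e r : q != 0 -> root q r -> absv r < e ->
  exists2 i, (0 < i)%N & absv q`_0 < absv q`_i * e ^+ i.
Proof.
move=> q0 /rootP qr re; apply: contrapT => nq.
have {}nq i : (0 < i)%N -> absv q`_i * e ^+ i <= absv q`_0.
  by move=> i0; rewrite leNgt; apply/negP => qi; apply: nq; exists i.
have e0 : 0 < e by apply: le_lt_trans re; exact: absv_ge0.
have [q00|q00] := eqVneq q`_0 0.
  move/eqP: q0; apply; apply/polyP => i; rewrite coef0.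
  have [->//|i0] := posnP i; have := nq i i0.
  rewrite q00 absv0 pmulr_lle0 ?exprn_gt0 // => qi.
  by apply/eqP; rewrite -absv_eq0b eq_le qi absv_ge0.
have qgt : 0 < absv q`_0 by rewrite absv_gt0.
have : absv (- \sum_(1 <= i < size q) q`_i * r ^+ i) < absv q`_0.
  rewrite absvN big_seq; apply: absv_sum_lt => // i; rewrite mem_index_iota => /andP[i0 _].
  rewrite absvM absvX; have [->|qi0] := eqVneq q`_i 0; first by rewrite absv0 mul0r.
  apply: lt_le_trans (nq i i0); rewrite ltr_pM2l ?absv_gt0 // ltrXn2r ?absv_ge0 //.
    by rewrite -lt0n.
suff -> : - \sum_(1 <= i < size q) q`_i * r ^+ i = q`_0 by rewrite ltxx.
move: qr; rewrite horner_coef -(big_mkord xpredT (fun i => q`_i * r ^+ i)).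
by rewrite big_ltn ?size_poly_gt0 // expr0 mulr1 => /eqP; rewrite addr_eq0 => /eqP ->.
Qed.

End Roots.

(** * Limits of algebraically closed subfields *)

(** Two instances are used: the closure of a single field ([acE]), and the limit of the fields
    generated by tuples that tend to a given one ([cl_open]). *)
Definition limset (R : realType) (F : valuedFieldType R) (I : Type)
    (U : set_system I) (A : I -> set F) : set F :=
  [set x | forall e : R, 0 < e ->
     \forall i \near U, exists2 y, A i y & absv (x - y) < e].

Section Limits.
Variables (R : realType) (F : valuedFieldType R) (I : Type).
Variables (U : set_system I) (FU : Filter U) (A : I -> set F).
Hypothesis sA : forall i, subfield (A i).

Lemma limset_incl x : (\forall i \near U, A i x) -> limset U A x.
Proof.
move=> Ax e e0; apply: filterS Ax => i Ax; exists x => //.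
by rewrite subrr absv0.
Qed.

Lemma limset_closed x :
  (forall e : R, 0 < e -> exists2 y, limset U A y & absv (x - y) < e) -> limset U A x.
Proof.
move=> xl e e0; have [y ly xy] := xl e e0.
apply: filterS (ly e e0) => i [z Az yz]; exists z => //.
exact: absv_lt_trans xy yz.
Qed.

Lemma limset_mul x y : limset U A x -> limset U A y -> limset U A (x * y).
Proof.
move=> lx ly e e0; pose M := 1 + absv x + absv y.
have M0 : 0 < M by rewrite ltr_pwDl ?absv_ge0 // ltr_pwDl ?absv_ge0.
pose d := Num.min 1 (e / M); have d0 : 0 < d by rewrite lt_min ltr01 divr_gt0.
apply: filterS2 (lx d d0) (ly d d0) => i [x' Ax' xx'] [y' Ay' yy'].
exists (x' * y'); first exact: subfieldM.
have -> : x * y - x' * y' = x * (y - y') + (x - x') * y'.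
  by rewrite mulrBr mulrBl addrA subrK.
have eM (z : F) : absv z < d -> absv z * M < e.
  by rewrite lt_min => /andP[_]; rewrite ltr_pdivlMr.
apply: absv_lt; rewrite absvM.
  apply: le_lt_trans (eM _ yy'); rewrite mulrC ler_wpM2l ?absv_ge0 //.
  by rewrite /M addrAC lerDr addr_ge0 ?absv_ge0.
apply: le_lt_trans (eM _ xx'); rewrite ler_wpM2l ?absv_ge0 //.
rewrite -[y'](subrKC y) -[y' - y]opprB; apply: absv_leB.
  by rewrite /M lerDr addr_ge0 ?absv_ge0.
apply: (@le_trans _ _ 1); last by rewrite /M -addrA lerDl addr_ge0 ?absv_ge0.
by move: yy'; rewrite lt_min => /andP[/ltW].
Qed.

Lemma limset_inv x : limset U A x -> limset U A x^-1.
Proof.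
have [->|x0] := eqVneq x 0; first by rewrite invr0.
move=> lx e e0; have ax : 0 < absv x by rewrite absv_gt0.
have d0 : 0 < Num.min (absv x) (e * absv x ^+ 2).
  by rewrite lt_min ax mulr_gt0 ?exprn_gt0.
apply: filterS (lx _ d0) => i [y Ay]; rewrite lt_min => /andP[xy xy2].
have yx : absv y = absv x.
  by rewrite -[y](subrKC x) absv_eql // absvB.
have y0 : y != 0 by rewrite -absv_gt0 yx.
exists y^-1; first exact: subfieldV.
have -> : x^-1 - y^-1 = (y - x) / (x * y).
  by field; rewrite x0 y0.
by rewrite !absvM absvV absvM yx absvB ltr_pdivrMr // mulr_gt0.
Qed.

Lemma limset_subfield : subfield (limset U A).
Proof.
split.
- by apply: limset_incl; apply: filterE => i; case: (sA i).
- move=> x y lx ly e e0.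
  apply: filterS2 (lx e e0) (ly e e0) => i [x' Ax' xx'] [y' Ay' yy'].
  exists (x' - y'); first exact: subfieldB.
  have -> : x - y - (x' - y') = (x - x') - (y - y') by ring.
  exact: absv_ltB.
- by move=> x y lx ly; apply: limset_mul => //; exact: limset_inv.
Qed.

Hypothesis cF : GRing.closed_field_axiom F.
Hypothesis aA : forall i, alg (A i) `<=` A i.

(** Continuity of roots: a monic equation of [x] over the limit is approximated by monic equations
    of the same degree over [A i], whose value at [x] is small enough for [root_near]. *)
Lemma limset_alg : alg (limset U A) `<=` limset U A.
Proof.
move=> x /(alg_monic limset_subfield)[p [pm pl px]] e e0.
pose d := (size p).-1.
have sp : (1 < size p)%N by apply: root_size_gt1 px; exact: monic_neq0.
have spE : size p = d.+1 by rewrite prednK // ltnW.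
pose M := 1 + absv x; have M1 : 1 <= M by rewrite lerDl absv_ge0.
have MX0 : 0 < M ^+ d by rewrite exprn_gt0 // (lt_le_trans ltr01).
(* An error below [h] in each coefficient changes the value at [x] by less than [e ^+ d], as
   [absv x ^+ j <= M ^+ d] for [j < d]. *)
pose h := e ^+ d / M ^+ d; have h0 : 0 < h by rewrite divr_gt0 // exprn_gt0.
have : \forall i \near U, forall j : 'I_d, exists2 y, A i y & absv (p`_j - y) < h.
  by apply: filter_forall => j; exact: pl.
apply: filterS => i pA; have /choice[c cP] : forall j, exists y, (j < d)%N -> A i y /\ absv (p`_j - y) < h.
  move=> j; have [jd|] := ltnP j d; last by exists 0.
  by have [y] := pA (Ordinal jd); exists y.
pose r := \poly_(j < d) (c j - p`_j); pose q := p + r.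
have sr : (size r < size p)%N by rewrite spE ltnS size_poly.
have qm : q \is monic by rewrite monicE lead_coefDl // -monicE.
have sq : size q = size p by rewrite size_polyDl.
have qA : over (A i) q.
  move=> j; rewrite coefD coef_poly; case: ltnP => jd.
    by rewrite addrC subrK; have [] := cP j jd.
  rewrite addr0; have [->|] := eqVneq j d.
    by rewrite -/(lead_coef p) (monicP pm); case: (sA i).
  rewrite neq_ltn ltnNge jd /= => dj; rewrite nth_default ?spE //; exact: subfield0.
have [] := @root_near _ _ cF q x e qm; rewrite ?sq ?ltW //; last first.
  move=> y qy xy; exists y => //; apply: (aA _); exists q.
  by rewrite monic_neq0.
rewrite hornerD (rootP px) add0r -/d horner_poly.
apply: absv_sum_lt => [|j _]; first by rewrite exprn_gt0.
have [_ cj] := cP j (ltn_ord j); rewrite absvM absvX.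
rewrite absvB -[ltRHS](divfK (lt0r_neq0 MX0)) -/h.
apply: (@le_lt_trans _ _ (absv (p`_j - c j) * M ^+ d)); last by rewrite ltr_pM2r.
rewrite ler_wpM2l ?absv_ge0 //; apply: (@le_trans _ _ (M ^+ j)).
  by rewrite lerXn2r ?nnegrE ?absv_ge0 ?(le_trans ler01) // lerDr.
by rewrite ler_weXn2l // ltnW.
Qed.

End Limits.

Section Closure.
Variables (R : realType) (F : valuedFieldType R) (cF : GRing.closed_field_axiom F).
Implicit Types S T : set F.

(** The trace on [F] of the completed algebraic closure of the field generated by [S]. *)
Definition ac S : set F := [set x | forall e : R, 0 < e ->
  exists2 y, cl S y & absv (x - y) < e].

Lemma acE S : ac S = limset [set setT] (fun _ : unit => cl S).
Proof.
apply/seteqP; split=> x Sx e e0.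
  by rewrite /prop_near1 /=; apply/seteqP; split=> // i _; exact: Sx.
by have /= := Sx e e0; rewrite /prop_near1 /= => /seteqP[_ /(_ tt I)].
Qed.

Lemma ac_subfield S : subfield (ac S).
Proof. by rewrite acE; apply: limset_subfield => _; exact: cl_subfield. Qed.

Lemma ac_alg S : alg (ac S) `<=` ac S.
Proof.
rewrite acE; apply: limset_alg => // _; [exact: cl_subfield|exact: cl_alg].
Qed.

Lemma ac_closed S x :
  (forall e : R, 0 < e -> exists2 y, ac S y & absv (x - y) < e) -> ac S x.
Proof. by rewrite acE; exact: limset_closed. Qed.

Lemma cl_ac S : cl S `<=` ac S.
Proof. by move=> x Sx e e0; exists x; rewrite // subrr absv0. Qed.

Lemma ac_incl S : S `<=` ac S.
Proof. by move=> x /cl_incl/cl_ac. Qed.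

Lemma ac_mono S T : S `<=` T -> ac S `<=` ac T.
Proof. by move=> ST x Sx e e0; have [y /(cl_mono ST)] := Sx e e0; exists y. Qed.

Lemma cl_sub_ac S T : S `<=` ac T -> cl S `<=` ac T.
Proof. by apply: cl_min; [exact: ac_subfield|exact: ac_alg]. Qed.

Lemma ac_sub S T : S `<=` ac T -> ac S `<=` ac T.
Proof.
move=> /cl_sub_ac ST x Sx; apply: ac_closed => e e0.
by have [y /ST] := Sx e e0; exists y.
Qed.

(** Along the neighbourhoods of [w], the fields [cl] generated by [S] and [w'] have an algebraically
    closed limit, which contains [S] and the [w i] and hence [a]. *)
Lemma cl_open S n (w : nat -> F) a e : cl (S `|` w @` `I_n) a -> 0 < e ->
  exists2 d : R, 0 < d & forall w', (forall i, (i < n)%N -> absv (w i - w' i) < d) ->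
    exists2 b, cl (S `|` w' @` `I_n) b & absv (a - b) < e.
Proof.
move=> + e0; pose V (d : R) := [set w' : nat -> F | forall i, (i < n)%N -> absv (w i - w' i) < d].
pose U := filter_from [set d : R | 0 < d] V.
have FU : Filter U.
  apply: filter_from_filter; first by exists 1; exact: ltr01.
  move=> c d /= c0 d0; exists (Num.min c d); first by rewrite /= lt_min c0.
  by move=> w' ww; split=> i /ww; rewrite lt_min => /andP[].
have sA w' : subfield (cl (S `|` w' @` `I_n)) by exact: cl_subfield.
suff : cl (S `|` w @` `I_n) `<=` limset U (fun w' => cl (S `|` w' @` `I_n)).
  by move=> sub /sub/(_ e e0)[d d0 dV]; exists d.
apply: cl_min; first exact: limset_subfield.
  by apply: limset_alg => // w'; exact: cl_alg.
move=> x [Sx|[i /= ni <-]].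
  by apply: limset_incl; apply: filterE => w'; apply: cl_incl; left.
move=> c c0; exists c => // w' /(_ i ni) wi; exists (w' i) => //.
by apply: cl_incl; right; exists i.
Qed.

End Closure.

(** * Estimates on real powers *)

Section RealPowers.
Variable R : realType.
Implicit Types a b x e : R.

Lemma bernoulli x n : 0 <= x <= 1 -> 1 - x *+ n <= (1 - x) ^+ n.
Proof.
move=> /andP[x0 x1]; elim: n => [|n IH]; first by rewrite mulr0n subr0 expr0.
rewrite exprS; have : (1 - x) * (1 - x *+ n) <= (1 - x) * (1 - x) ^+ n.
  by rewrite ler_wpM2l // subr_ge0.
apply: le_trans; have : 0 <= x * (x *+ n) by rewrite mulr_ge0 // mulrn_wge0.
by rewrite mulrSr; lra.
Qed.

Lemma exprn_lt_small x e : 0 <= x < 1 -> 0 < e -> exists n, x ^+ n < e.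
Proof.
move=> /andP[]; rewrite le_eqVlt => /predU1P[<-|x0] x1 e0.
  by exists 1; rewrite expr1.
have h0 : 0 < x^-1 - 1 by rewrite subr_gt0 invf_gt1.
have bnd n : 1 + (x^-1 - 1) *+ n <= x^-1 ^+ n.
  elim: n => [|n IH]; first by rewrite mulr0n addr0 expr0.
  rewrite exprS; have : x^-1 * (1 + (x^-1 - 1) *+ n) <= x^-1 * x^-1 ^+ n.
    by rewrite ler_wpM2l // invr_ge0 ltW.
  apply: le_trans; have : 0 <= (x^-1 - 1) * ((x^-1 - 1) *+ n).
    by rewrite mulr_ge0 ?mulrn_wge0 // ltW.
  by rewrite mulrSr; lra.
pose n := Num.bound (e^-1 / (x^-1 - 1)); exists n.
have en : e^-1 < x^-1 ^+ n.
  apply: lt_le_trans (bnd n); apply: ltr_pwDl => //.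
  rewrite -mulr_natr mulrC -ler_pdivrMr //; apply/ltW/archi_boundP.
  by rewrite divr_ge0 ?invr_ge0 // ltW.
by move: en; rewrite exprVn ltf_pV2 // posrE ?exprn_gt0.
Qed.

Lemma exprn_near1 a b D : 0 <= a < b -> exists2 k, 0 < k < 1 & a < k ^+ D * b.
Proof.
move=> /andP[a0 ab]; have b0 : 0 < b by exact: le_lt_trans ab.
(* By Bernoulli's inequality [(1 - h) ^+ D * b >= (1 - h *+ D) * b], and this exceeds [a] for the
   present [h]. *)
pose h := (b - a) / (b *+ D.+2).
have bD : 0 < b *+ D.+2 by rewrite pmulrn_lgt0.
have h0 : 0 < h by rewrite divr_gt0 // subr_gt0.
have hE : h * (b *+ D.+2) = b - a by rewrite divfK // lt0r_neq0.
have h1 : h < 1.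
  rewrite ltr_pdivrMr // mul1r mulrSr; have : 0 < b *+ D.+1 by rewrite pmulrn_lgt0.
  lra.
exists (1 - h); first by lra.
have : (1 - h *+ D) * b <= (1 - h) ^+ D * b.
  by apply: ler_wpM2r; [exact: ltW|apply: bernoulli; rewrite !ltW].
apply: lt_le_trans; move: hE; rewrite !mulrSr -[h *+ D]mulr_natr -[b *+ D]mulr_natr.
have : 0 < h * b by rewrite mulr_gt0.
by nra.
Qed.

End RealPowers.

(** * Rigidity of distances *)

Section Rigidity.
Variables (R : realType) (F : valuedFieldType R) (cF : GRing.closed_field_axiom F).
Implicit Types (A : set F) (p : {poly F}).

Lemma nth_root (t : F) n : (0 < n)%N -> exists b, b ^+ n = t.
Proof.
move=> n0; have [b bE] := cF (fun i => if i == 0%N then t else 0) n0.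
exists b; rewrite bE; case: n n0 {bE} => // n _.
by rewrite big_ord_recl /= expr0 mulr1 big1 ?addr0 // => i _; rewrite mul0r.
Qed.

Lemma alg_root A (t b : F) n : subfield A -> alg A `<=` A -> A t -> (0 < n)%N ->
  b ^+ n = t -> A b.
Proof.
move=> sA aA At n0 bn; apply: aA; exists ('X^n - t%:P); split.
- by rewrite -size_poly_eq0 size_XnsubC.
- move=> i; rewrite coefB coefXn; apply: subfieldB => //; last by apply: overC => //; exact: subfield_subring.
  by case: (i == n); [case: sA|exact: subfield0].
- by rewrite /root !hornerE bn subrr.
Qed.

(** As [A] contains all roots of [t], its values are dense: a root [b] of [t] of high order
    satisfies [k < absv b ^+ n.+2], so a geometric progression of ratio [absv b] has [n + 1] terms
    between [s] and [s / k]. *)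
Lemma value_dense A (t : F) (s k : R) n : subfield A -> alg A `<=` A ->
  A t -> 0 < absv t < 1 -> 0 < s -> 0 < k < 1 ->
  exists a : nat -> F, forall i, (i <= n)%N ->
    [/\ A (a i), s <= absv (a i), k * absv (a i) < s
      & forall j, (j < i)%N -> absv (a j) < absv (a i)].
Proof.
move=> sA aA At /andP[t0 t1] s0 /andP[k0 k1].
have [N kN] : exists N, k ^+ N < absv t by apply: exprn_lt_small => //; rewrite ltW.
have [b bE] := nth_root t (isT : (0 < n.+2 * N.+1)%N).
have Ab : A b by exact: alg_root bE.
have bX : absv b ^+ (n.+2 * N.+1) = absv t by rewrite -absvX bE.
have b1 : absv b < 1.
  by rewrite ltNge; apply/negP => /(exprn_ege1 (n.+2 * N.+1)); rewrite bX leNgt t1.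
have b0 : 0 < absv b.
  rewrite absv_gt0; apply: contraTneq t0 => b0; rewrite -bX b0 absv0 expr0n.
  by rewrite muln_eq0 /= ltxx.
have kb : k < absv b ^+ n.+2.
  rewrite ltNge; apply/negP => bk; move: kN; apply/negP; rewrite -leNgt -bX exprM.
  apply: (@le_trans _ _ (k ^+ N.+1)).
    by rewrite lerXn2r ?nnegrE ?exprn_ge0 // ltW.
  by rewrite exprS ler_piMl ?exprn_ge0 // ltW.
have [j tj] : exists j, absv t ^+ j < s^-1.
  by apply: exprn_lt_small; rewrite ?invr_gt0 // t1 ltW.
have [c Ac cs] : exists2 c, A c & s <= absv c.
  exists (t ^- j); first by apply: subfieldV => //; exact: subfieldX.
  by rewrite absvV absvX ltW // -(invrK s) ltf_pV2 // posrE ?invr_gt0 ?exprn_gt0.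
have c0 : 0 < absv c by exact: lt_le_trans cs.
have [m bm] : exists m, absv c * absv b ^+ m < s.
  have [m bm] : exists m, absv b ^+ m < s / absv c.
    by apply: exprn_lt_small; rewrite ?divr_gt0 // b1 ltW.
  by exists m; rewrite mulrC -ltr_pdivlMr.
(* By minimality of [l], [c * b ^+ l.-1] is the last term whose absolute value is at least [s]; the
   points [a i] go upwards from it. *)
have [l bl lmin] := ex_minnP (ex_intro (fun m => absv c * absv b ^+ m < s) m bm).
have l0 : (0 < l)%N.
  by rewrite lt0n; apply: contraTneq bl => ->; rewrite mulr1 -leNgt.
have bs : s <= absv c * absv b ^+ l.-1.
  rewrite leNgt; apply/negP => /lmin; rewrite leqNgt => /negP; apply.
  by rewrite prednK.
have bXn i : (0 < absv b ^- i) by rewrite invr_gt0 exprn_gt0.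
exists (fun i => c * b ^+ l.-1 / b ^+ i) => i ni.
rewrite !(absvM, absvV, absvX); split.
- by apply: subfieldM; [|apply: subfieldM|apply: subfieldV] => //; exact: subfieldX.
- apply: le_trans bs _. idtac. rewrite ler_pMr ?mulr_gt0 ?exprn_gt0 //.
  by rewrite invf_ge1 ?exprn_gt0 // exprn_ile1 // ltW.
- rewrite mulrA ltr_pdivrMr ?exprn_gt0 //.
  apply: (@le_lt_trans _ _ (absv b ^+ i.+1 * (absv c * absv b ^+ l.-1))).
    rewrite ler_wpM2r ?mulr_ge0 ?exprn_ge0 ?absv_ge0 //.
    by apply: le_trans (ltW kb) _; apply: ler_wiXn2l; rewrite ?absv_ge0 ?(ltW b1) // ltnW.
  have -> : absv b ^+ i.+1 * (absv c * absv b ^+ l.-1) = absv c * absv b ^+ l * absv b ^+ i.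
    by rewrite -{2}(prednK l0) !exprS; ring.
  by rewrite ltr_pM2r ?exprn_gt0.
- move=> j' ji; rewrite !(absvM, absvV, absvX) ltr_pM2l ?mulr_gt0 ?exprn_gt0 //.
  by rewrite ltf_pV2 ?posrE ?exprn_gt0 // ltr_iXn2l.
Qed.

(* The points [z0 + a i], for [a] as in [value_dense], are at mutual distance
   at least [s], so that one of them avoids the open balls of radius [s]
   around the roots. *)
Lemma avoid_roots A (t x : F) (s k : R) (rs : seq F) : subfield A -> alg A `<=` A ->
  A t -> 0 < absv t < 1 -> 0 < k < 1 -> 0 < s ->
  (exists2 z, A z & k * absv (x - z) < s) ->
  (forall r, r \in rs -> s <= absv (x - r)) ->
  exists2 z, A z & forall r, r \in rs ->
    k * absv (x - r) <= absv (z - r) /\ k * absv (z - r) <= absv (x - r).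
Proof.
move=> sA aA At t01 k01 s0 [z0 Az0 xz0] xrs; have /andP[k0 k1] := k01.
have [a aP] := value_dense (size rs) sA aA At t01 s0 k01.
have far i j r : (j < i <= size rs)%N ->
    absv (z0 + a i - r) < s -> absv (z0 + a j - r) < s -> False.
  move=> /andP[ji ir] ri rj; have [_ si _ /(_ _ ji) aij] := aP i ir.
  have : absv (a i - a j) < s.
    have -> : a i - a j = (z0 + a i - r) - (z0 + a j - r) by ring.
    exact: absv_ltB.
  by rewrite absv_eql ?absvN // ltNge si.
have [i ir ai] : exists2 i, (i <= size rs)%N &
    forall r, r \in rs -> s <= absv (z0 + a i - r).
  apply: contrapT => nex.
  (* Otherwise each of the [size rs + 1] points is within [s] of a root, and two of them share a
     root by the pigeonhole principle. *)
  have /choice[f fP] : forall i : 'I_(size rs).+1, exists j : 'I_(size rs),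
      absv (z0 + a i - rs`_j) < s.
    move=> i; apply: contrapT => nj; apply: nex; exists i => [|r /(nthP 0)[j jr <-]].
      exact: (ltn_ord i).
    by rewrite leNgt; apply/negP => rj; apply: nj; exists (Ordinal jr).
  suff /leq_card : injective f by rewrite !card_ord ltnn.
  move=> i j fij; apply/val_inj/eqP; have ri := fP i; have rj := fP j.
  rewrite fij in ri; have [||//] := ltngtP i j => ij; exfalso.
    by apply: (far j i _ _ rj ri); rewrite ij -ltnS ltn_ord.
  by apply: (far i j _ _ ri rj); rewrite ij -ltnS ltn_ord.
have [Aai sai kai _] := aP i ir.
exists (z0 + a i) => [|r rrs]; first exact: subfieldD.
have xz : k * absv (x - (z0 + a i)) < s.
  rewrite opprD addrA; apply: le_lt_trans (_ : k * Num.max (absv (x - z0)) (absv (a i)) < s).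
    by rewrite ler_pM2l // -[absv (a i)]absvN absv_ultra.
  by rewrite maxr_pMr ?(ltW k0) // gt_max xz0.
have xr := xrs _ rrs; have zr := ai _ rrs.
have tri (u v w : F) : k * absv (u - w) < s -> s <= absv (u - v) -> k * absv (w - v) <= absv (u - v).
  move=> uw uv; have -> : w - v = (u - v) - (u - w) by ring.
  have := absv_ultra (u - v) (- (u - w)); rewrite absvN le_max => /orP[h|h].
    apply: le_trans (_ : k * absv (u - v) <= _); first by rewrite ler_pM2l.
    by rewrite ler_piMl ?absv_ge0 // ltW.
  apply: le_trans uv; apply: le_trans (ltW uw).
  by rewrite ler_pM2l.
by split; [apply: tri zr; rewrite absvB|exact: tri].
Qed.

Lemma poly_over_roots A p : subfield A -> alg A `<=` A -> over A p -> p != 0 ->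
  exists2 rs, (forall r, r \in rs -> A r) &
    forall z, absv p.[z] = absv (lead_coef p) * \prod_(r <- rs) absv (z - r).
Proof.
move=> sA aA pA p0; have [rs prs] := closed_field_split cF p0; exists rs.
  move=> r rrs; apply: aA; exists p; split=> //.
  by rewrite prs rootZ ?lead_coef_eq0 // root_prod_XsubC.
move=> z; rewrite {1}prs hornerZ absvM horner_prod absv_prod.
by congr (_ * _); apply: eq_bigr => r _; rewrite hornerXsubC.
Qed.

Lemma ler_prod_scale (k : R) (rs : seq F) (f g : F -> R) : 0 <= k ->
  (forall r, r \in rs -> 0 <= f r /\ k * f r <= g r) ->
  k ^+ size rs * \prod_(r <- rs) f r <= \prod_(r <- rs) g r.
Proof.
move=> k0; elim: rs => [|r rs IH] fg; first by rewrite !big_nil mulr1.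
rewrite !big_cons exprS mulrACA; have [f0 kf] := fg r (mem_head _ _).
apply: ler_pM => //; first by rewrite mulr_ge0.
  rewrite mulr_ge0 ?exprn_ge0 // big_seq prodr_ge0 // => s srs.
  by have [] := fg s; rewrite ?inE ?srs ?orbT.
by apply: IH => s srs; apply: fg; rewrite inE srs orbT.
Qed.

(* Both polynomials split over [A'], and by [avoid_roots] some [z] in [A] has
   nearly the same distances as [x] to all their roots. *)
Lemma specialize A A' (t x : F) (f g : {poly F}) (c : R) :
  subfield A -> alg A `<=` A -> A t -> 0 < absv t < 1 ->
  subfield A' -> alg A' `<=` A' ->
  (exists2 s : R, 0 < s & (forall a, A' a -> s <= absv (x - a)) /\
     forall k, 0 < k < 1 -> exists2 z, A z & k * absv (x - z) < s) ->
  over A' f -> over A' g -> 0 < c -> absv f.[x] < absv g.[x] * c ->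
  exists2 z, A z & absv f.[z] < absv g.[z] * c.
Proof.
move=> sA aA At t01 sA' aA' [s s0 [sA'x Asx]] fA gA c0 fg.
have g0 : g != 0.
  by apply: contraTneq fg => ->; rewrite horner0 absv0 mul0r -leNgt absv_ge0.
have [rg rgA gE] := poly_over_roots sA' aA' gA g0.
have [f0|f0] := eqVneq f 0.
  have h01 : 0 < (2^-1 : R) < 1 by rewrite invr_gt0 ltr0n invf_lt1 ?ltr1n ?ltr0n.
  have rgs r : r \in rg -> s <= absv (x - r) by move=> /rgA; exact: sA'x.
  have [z Az zP] := avoid_roots sA aA At t01 h01 s0 (Asx _ h01) rgs.
  exists z => //; rewrite f0 horner0 absv0 mulr_gt0 // gE mulr_gt0 //.
    by rewrite absv_gt0 lead_coef_eq0.
  rewrite big_seq prodr_gt0 // => r rr; have [kr _] := zP r rr.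
  apply: lt_le_trans kr; rewrite mulr_gt0 ?invr_gt0 ?ltr0n //.
  by apply: (lt_le_trans s0); exact: rgs.
have [rf rfA fE] := poly_over_roots sA' aA' fA f0.
(* [k] is so close to 1 that losing a factor [k] at every root of [f] and [g] preserves the strict
   inequality. *)
have [k k01 kfg] : exists2 k, 0 < k < 1 &
    absv f.[x] < k ^+ (size rf + size rg) * (absv g.[x] * c).
  by apply: exprn_near1; rewrite absv_ge0.
have rfgs r : r \in rf ++ rg -> s <= absv (x - r).
  by rewrite mem_cat => /orP[/rfA|/rgA]; exact: sA'x.
have [z Az zP] := avoid_roots sA aA At t01 k01 s0 (Asx _ k01) rfgs.
exists z => //; have /andP[k0 k1] := k01.
have kf : k ^+ size rf * absv f.[z] <= absv f.[x].
  rewrite !fE mulrCA ler_wpM2l ?absv_ge0 //; apply: ler_prod_scale; rewrite ?ltW // => r rr.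
  by have [] := zP r; rewrite ?mem_cat ?rr // absv_ge0.
have kg : k ^+ size rg * absv g.[x] <= absv g.[z].
  rewrite !gE mulrCA ler_wpM2l ?absv_ge0 //; apply: ler_prod_scale; rewrite ?ltW // => r rr.
  by have [] := zP r; rewrite ?mem_cat ?rr ?orbT // absv_ge0.
rewrite -(ltr_pM2l (exprn_gt0 (size rf) k0)); apply: (le_lt_trans kf).
apply: (lt_le_trans kfg); rewrite exprD -mulrA ler_pM2l ?exprn_gt0 //.
by rewrite mulrA ler_wpM2r // ltW.
Qed.

(** An element [y] of [A'] is close to some [b] with a relation [P] over A[x]. After translating by
    [y], this closeness is, by [newton_coef], an inequality between values at [x] of polynomials
    over [A']. By [specialize] it also holds at some [z] in [A], where [newton_root] yields a root
    near [y] that is algebraic over [A]. *)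
Lemma dist_rigid A A' (t x : F) : subfield A -> alg A `<=` A -> A t -> 0 < absv t < 1 ->
  (forall y, (forall e : R, 0 < e -> exists2 a, A a & absv (y - a) < e) -> A y) ->
  subfield A' -> alg A' `<=` A' -> A `<=` A' ->
  (forall a e, A' a -> 0 < e -> exists2 b, A b & absv (x - b) < absv (x - a) + e) ->
  A' `<=` ac (A `|` [set x]) -> A' `<=` A.
Proof.
move=> sA aA At t01 clA sA' aA' AA' dAA' sub y A'y.
have [Ax|nAx] := pselect (A x).
  apply: (clA) => e e0; have [b Axb yb] := sub y A'y e e0; exists b => //.
  by apply: cl_min Axb => // z [//|->].
apply: (clA) => e e0; have [b Axb yb] := sub y A'y e e0.
have [P [PA P0 Pb]] := cl_adjoin sA Axb.
pose Q := P \Po ('X + y%:P%:P).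
have QE z : map_poly (horner_eval z) Q = map_poly (horner_eval z) P \Po ('X + y%:P).
  by rewrite map_comp_poly rmorphD /= map_polyX map_polyC /= /horner_eval hornerC.
have shiftK (p : {poly F}) : p \Po ('X + y%:P) \Po ('X - y%:P) = p.
  by rewrite -comp_polyA comp_polyD comp_polyX comp_polyC subrK comp_polyXr.
have shift0 (p : {poly F}) : (p \Po ('X + y%:P) == 0) = (p == 0).
  apply/eqP/eqP => [p0|->]; last by rewrite comp_poly0.
  by rewrite -(shiftK p) p0 comp_poly0.
have rootE (p : {poly F}) r : root (p \Po ('X + y%:P)) r = root p (r + y).
  by rewrite /root horner_comp !hornerE.
have QA : over (over A') Q.
  have sO := over_subring (subfield_subring sA'); have sOO := over_subring sO.
  apply: (over_comp sO) => [i|]; first exact: (over_sub AA' (PA i)).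
  apply: (subringD sOO); first exact: (overX sO).
  by apply: (overC sO); apply: (overC (subfield_subring sA')).
have [i i0 Qi] : exists2 i, (0 < i)%N & absv (Q`_0).[x] < absv (Q`_i).[x] * e ^+ i.
  have := newton_coef (q := map_poly (horner_eval x) Q) (r := b - y) (e := e).
  rewrite QE shift0 rootE subrK absvB -QE => /(_ P0 Pb yb)[i i0].
  by rewrite !coef_map_id0 /horner_eval ?horner0 //; exists i.
pose S := [set absv (x - a) | a in A]; pose s := inf S.
have Sinf : has_inf S.
  split; first by exists (absv (x - 0)), 0 => //; exact: subfield0.
  by exists 0 => _ [a _ <-]; exact: absv_ge0.
have sS a : A a -> s <= absv (x - a) by move=> Aa; apply: ge_inf; [case: Sinf|exists a].
(* [A] is closed and does not contain [x], so the distance [s] from [x] to [A] is positive. *)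
have s0 : 0 < s.
  rewrite ltNge; apply/negP => s0; apply: nAx; apply: (clA) => d d0.
  have [_ [a Aa <-] as_] := inf_adherent d0 Sinf; exists a => //.
  by apply: (lt_le_trans as_); rewrite gerDr.
have [z Az Qz] : exists2 z, A z & absv (Q`_0).[z] < absv (Q`_i).[z] * e ^+ i.
  apply: (@specialize A A' t x) => //; last exact: exprn_gt0.
  exists s => //; split=> [a A'a|k /andP[k0 k1]].
    apply/ler_addgt0Pr => d d0; have [c Ac ca] := dAA' a d A'a d0.
    by apply: (le_trans (sS c Ac)); exact: ltW.
  have ks : 0 < s / k - s.
    by rewrite subr_gt0 ltr_pdivlMr // gtr_pMr.
  have [_ [a Aa <-]] := inf_adherent ks Sinf; rewrite subrKC => ak.
  by exists a => //; rewrite mulrC -ltr_pdivlMr.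
have [r Qr re] : exists2 r, root (map_poly (horner_eval z) Q) r & absv r < e.
  by apply: (newton_root cF i0 e0); rewrite !coef_map_id0 /horner_eval ?horner0.
exists (r + y); last by rewrite opprD addrCA subrr addr0 absvN.
apply: aA; exists (map_poly (horner_eval z) P); split.
- rewrite -shift0 -QE; apply/eqP => /polyP/(_ i); rewrite coef0 coef_map_id0 /horner_eval ?horner0 // => Qi0.
  by move: Qz; rewrite Qi0 absv0 mul0r ltNge absv_ge0.
- move=> j; rewrite coef_map_id0 /horner_eval ?horner0 //.
  by apply: subring_horner => //; exact: subfield_subring.
- by rewrite -rootE -QE.
Qed.

End Rigidity.

(** * Countable generation *)

Section FiniteSupport.
Variable F : fieldType.
Implicit Types S T : set F.

Lemma gen_finite S q : gen S q ->
  exists2 s, (forall z, z \in s -> S z) & gen (lset s) q.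
Proof.
apply: (@gen_min _ _ [set q | exists2 s, (forall z, z \in s -> S z) & gen (lset s) q]).
  have two x y : (exists2 s, (forall z, z \in s -> S z) & gen (lset s) x) ->
      (exists2 s, (forall z, z \in s -> S z) & gen (lset s) y) ->
      exists2 s, (forall z, z \in s -> S z) & gen (lset s) x /\ gen (lset s) y.
    move=> [s sS sx] [u uS uy]; exists (s ++ u).
      by move=> z; rewrite mem_cat => /orP[/sS|/uS].
    by split; [move: sx|move: uy]; apply: gen_mono => z;
      rewrite /lset /= mem_cat => ->; rewrite ?orbT.
  split; first by exists [::] => //; have [h _ _] := gen_subfield (lset [::] : set F).
    move=> x y hx hy; have [s sS [sx sy]] := two x y hx hy; exists s => //.
    exact: subfieldB (gen_subfield _) sx sy.
  move=> x y hx hy; have [s sS [sx sy]] := two x y hx hy; exists s => //.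
  by have [_ _ AV] := gen_subfield (lset s); exact: AV.
move=> x Sx; exists [:: x]; first by move=> z; rewrite inE => /eqP->.
by apply: gen_incl; rewrite /lset /= inE.
Qed.

Lemma cl_finite S T a : cl (S `|` T) a ->
  exists2 s, (forall z, z \in s -> S z) & cl (lset s `|` T) a.
Proof.
move=> [p [p0 pS pa]].
have /choice[s sP] : forall i, exists s, (forall z, z \in s -> (S `|` T) z) /\ gen (lset s) p`_i.
  by move=> i; have [s] := gen_finite (pS i); exists s.
pose u := flatten [seq s i | i <- iota 0 (size p)].
exists [seq z <- u | z \in S].
  by move=> z; rewrite mem_filter => /andP[/set_mem].
exists p; split=> // i; have [ip|ip] := ltnP i (size p); last first.
  by rewrite nth_default //; apply: subfield0; exact: gen_subfield.
have [sST] := sP i; apply: gen_mono => z /= zs.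
have [Sz|] := sST z zs; last by right.
left; rewrite /lset /= mem_filter; apply/andP; split; first exact: mem_set.
by apply/flattenP; exists (s i) => //; apply/mapP; exists i => //; rewrite mem_iota.
Qed.

End FiniteSupport.

Section CountablyGenerated.
Variables (R : realType) (F : valuedFieldType R) (cF : GRing.closed_field_axiom F).
Implicit Types (A B S M : set F).

Lemma minimizing_sequence S (x : F) : exists2 a : nat -> F, (forall k, cl S (a k)) &
  forall b e, ac S b -> 0 < e -> exists k, absv (x - a k) < absv (x - b) + e.
Proof.
pose D := [set absv (x - a) | a in cl S].
have Dinf : has_inf D.
  split; first by exists (absv (x - 0)), 0 => //; apply: subfield0; exact: cl_subfield.
  by exists 0 => _ [a _ <-]; exact: absv_ge0.
have k0 k : 0 < (2^-1 : R) ^+ k by rewrite exprn_gt0 // invr_gt0.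
have /choice[a aP] : forall k, exists a, cl S a /\ absv (x - a) < inf D + (2^-1) ^+ k.
  by move=> k; have [_ [a Sa <-] ak] := inf_adherent (k0 k) Dinf; exists a.
exists a => [k|b e Sb e0]; first by case: (aP k).
have e20 : 0 < e / 2 by rewrite divr_gt0.
have [k ke] : exists k, (2^-1 : R) ^+ k < e / 2.
  by apply: exprn_lt_small; rewrite // invr_ge0 ler0n invf_lt1 ?ltr1n ?ltr0n.
exists k; have [_ ak] := aP k; have [c Sc bc] := Sb _ e20.
have Dc : inf D <= absv (x - c) by apply: ge_inf; [case: Dinf|exists c].
have xc : absv (x - c) <= absv (x - b) + e / 2.
  rewrite -(subrKA b); apply: le_trans (absv_ultra _ _) _.
  by rewrite ge_max lerDl (ltW e20) /= (le_trans (ltW bc)) // lerDr absv_ge0.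
by lra.
Qed.

(* For a suitable countable set [y] in [M], every [x i] is as far from the
   closure of [M] and the previous [x j] as from that of [y] and the previous
   [x j]; by [dist_rigid] these closures coincide, by descending induction on [i]. *)
Lemma countably_generated M B (t : F) (x : nat -> F) n :
  subfield M -> B `<=` M -> M t -> 0 < absv t < 1 -> M `<=` ac (B `|` x @` `I_n) ->
  exists2 y : nat -> F, (forall m, M (y m)) & M `<=` ac (B `|` range y).
Proof.
move=> sM BM Mt t01 Mx.
have /choice[a aP] : forall i, exists a : nat -> F, (forall k, cl (M `|` x @` `I_i) (a k)) /\
    forall b e, ac (M `|` x @` `I_i) b -> 0 < e ->
    exists k, absv (x i - a k) < absv (x i - b) + e.
  by move=> i; have [a] := minimizing_sequence (M `|` x @` `I_i) (x i); exists a.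
have /choice[s sP] : forall ik : nat * nat, exists s, (forall z, z \in s -> M z) /\
    cl (lset s `|` x @` `I_(ik.1)) (a ik.1 ik.2).
  by move=> [i k]; have [/(_ k)/cl_finite[s]] := aP i; exists s.
(* [y] enumerates the finite supports [s (i, k)] of all the approximants, padded with [t]. Its term
   0 is [t], which makes [t] available to [dist_rigid]. *)
pose y m := if m is m'.+1 then
  if @unpickle (nat * nat * nat)%type m' is Some (ik, l) then nth t (s ik) l else t else t.
have yM m : M (y m).
  case: m => //= m; case: unpickle => // -[ik l].
  have [ls|ls] := ltnP l (size (s ik)); last by rewrite nth_default.
  by have [sM' _] := sP ik; apply: sM'; exact: mem_nth.
have sy i k z : z \in s (i, k) -> range y z.
  by move=> /(nthP t)[l _ <-]; exists (pickle (i, k, l)).+1; rewrite //= pickleK.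
exists y => //; pose Y := B `|` range y.
have YM : Y `<=` M by move=> z [/BM//|[m _ <-]].
(* Here [i] counts the last [x j] that have already been removed on both sides. *)
suff H i : (i <= n)%N -> ac (M `|` x @` `I_(n - i)) `<=` ac (Y `|` x @` `I_(n - i)).
  have := H n (leqnn n); rewrite subnn => H0 z Mz.
  apply: (ac_mono (S := Y `|` x @` `I_0)) => [u [//|[j /=]]|]; first by rewrite ltn0.
  by apply: H0; apply: ac_incl; left.
elim: i => [_|i IH ni].
  rewrite subn0; apply: ac_sub => // z [/Mx|xz]; last by apply: ac_incl; right.
  by apply: ac_mono => u [Bu|]; [do 2!left|right].
have {IH} := IH (ltnW ni); have [j nE nE'] : exists2 j, (n - i = j.+1)%N & (n - i.+1 = j)%N.
  by exists (n - i.+1)%N; rewrite ?subnSK.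
rewrite nE nE' => IH; apply: (@dist_rigid _ _ cF _ _ t (x j)) => //.
- exact: ac_subfield.
- exact: ac_alg.
- by apply: ac_incl; left; right; exists 0%N.
- exact: ac_closed.
- exact: ac_subfield.
- exact: ac_alg.
- by apply: ac_mono => u [/YM|]; [left|right].
- move=> b e Mb e0; have [_ /(_ b e Mb e0)[k ak]] := aP j; exists (a j k) => //.
  apply: cl_ac; have [_] := sP (j, k); apply: cl_mono => z [zs|]; last by right.
  by left; right; exact: sy zs.
- move=> z Mz; have : ac (M `|` x @` `I_j.+1) z.
    apply: ac_mono Mz => u [|[l lj <-]]; first by left.
    by right; exists l => //; exact: leqW.
  move/IH; apply: ac_sub => // u [Yu|[l /= lj <-]].
    by apply: ac_incl; left; apply: ac_incl; left.
  have [lj'|jl] := ltnP l j.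
    by apply: ac_incl; left; apply: ac_incl; right; exists l.
  by apply: ac_incl; right; congr x; apply/eqP; rewrite eqn_leq jl andbT.
Qed.

End CountablyGenerated.

(** * Polynomial relations and the choice of slopes *)

(* Formal expressions stand for polynomials in several variables: all that is
   needed is that evaluation commutes with ring morphisms. *)
Inductive pexp (F : Type) :=
  | PConst of F
  | PVar of nat
  | PAdd of pexp F & pexp F
  | PMul of pexp F & pexp F.

Section PolynomialExpressions.
Variable F : fieldType.
Implicit Types (B : set F) (e : pexp F).

Fixpoint pev (A : comNzRingType) (phi : F -> A) (s : nat -> A) (e : pexp F) : A :=
  match e with
  | PConst c => phi c
  | PVar i => s i
  | PAdd e1 e2 => pev phi s e1 + pev phi s e2
  | PMul e1 e2 => pev phi s e1 * pev phi s e2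
  end.

Fixpoint pwf B n (e : pexp F) : Prop :=
  match e with
  | PConst c => B c
  | PVar i => (i < n)%N
  | PAdd e1 e2 | PMul e1 e2 => pwf B n e1 /\ pwf B n e2
  end.

Lemma pev_morph (A A' : comNzRingType) (f : {rmorphism A -> A'}) (phi : F -> A)
    (phi' : F -> A') s s' e :
  (forall c, f (phi c) = phi' c) -> (forall i, f (s i) = s' i) ->
  f (pev phi s e) = pev phi' s' e.
Proof.
by move=> fphi fs; elim: e => //= e1 <- e2 <-; rewrite ?rmorphD ?rmorphM.
Qed.

Lemma eq_pev (A : comNzRingType) (phi : F -> A) s s' B n e : pwf B n e ->
  (forall i, (i < n)%N -> s i = s' i) -> pev phi s e = pev phi s' e.
Proof.
move=> + ss; elim: e => [c|i|e1 IH1 e2 IH2|e1 IH1 e2 IH2] //=; first exact: ss.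
  by move=> [/IH1-> /IH2->].
by move=> [/IH1-> /IH2->].
Qed.

Lemma pev_subring (A : comNzRingType) (phi : F -> A) s B n e (D : set A) : subring D ->
  (forall c, B c -> D (phi c)) -> (forall i, (i < n)%N -> D (s i)) ->
  pwf B n e -> D (pev phi s e).
Proof.
move=> sD phiD sDi; elim: e => [c|i|e1 IH1 e2 IH2|e1 IH1 e2 IH2] /=.
- exact: phiD.
- exact: sDi.
- by move=> [/IH1 D1 /IH2 D2]; exact: (subringD sD).
- by move=> [/IH1 D1 /IH2 D2]; exact: (subringM sD).
Qed.

Definition pvals B n (s : nat -> F) : set F := [set pev id s e | e in pwf B n].

Lemma pvals_subring B n s : subfield B -> subring (pvals B n s).
Proof.
move=> sB; have B1 : B 1 by case: sB.
split; first by exists (PConst 1).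
- move=> _ _ [e1 B1e <-] [e2 B2e <-]; exists (PAdd e1 (PMul (PConst (-1)) e2)).
    by do 2!split=> //; exact: subfieldN.
  by rewrite /= mulN1r.
- by move=> _ _ [e1 B1e <-] [e2 B2e <-]; exists (PMul e1 e2).
Qed.

(** The polynomial in the variable [n] with coefficients [es], in Horner form. *)
Definition phorner n (es : seq (pexp F)) : pexp F :=
  foldr (fun e p => PAdd e (PMul (PVar F n) p)) (PConst 0) es.

Lemma pev_horner (A : comNzRingType) (phi : {rmorphism F -> A}) s n es :
  pev phi s (phorner n es) = (Poly [seq pev phi s e | e <- es]).[s n].
Proof.
by elim: es => [|e es IH] /=; rewrite ?rmorph0 ?horner0 // horner_cons IH addrC mulrC.
Qed.

Lemma pwf_horner B n es : subfield B -> (forall e, List.In e es -> pwf B n e) ->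
  pwf B n.+1 (phorner n es).
Proof.
move=> sB; elim: es => [|e es IH] /= esB; first exact: subfield0.
split; last by split=> //; apply: IH => e' ee'; apply: esB; right.
have : pwf B n e by apply: esB; left.
elim: {IH esB} e => [c|i|e1 IH1 e2 IH2|e1 IH1 e2 IH2] //=; first exact: leqW.
  by move=> [/IH1 ? /IH2 ?].
by move=> [/IH1 ? /IH2 ?].
Qed.

(** After clearing denominators, the coefficients of the equation of [s n] are polynomial
    expressions in the previous [s i], so the relation makes sense at other points too. *)
Lemma cl_relation B n (s : nat -> F) : subfield B -> cl (B `|` s @` `I_n) (s n) ->
  exists es, [/\ forall e, List.In e es -> pwf B n e,
    Poly [seq pev id s e | e <- es] != 0 & root (Poly [seq pev id s e | e <- es]) (s n)].
Proof.
move=> sB [p [p0 pS pn]].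
have sV := pvals_subring n s sB.
have [c [_ c0] cp] : exists2 c, pvals B n s c /\ c != 0 & over (pvals B n s) (c *: p).
  apply: clear_denominators => // i; apply: gen_min (pS i).
    exact: fractions_subfield.
  move=> x Bx; apply: fractions_incl => //.
  case: Bx => [Bx|[k /= kn <-]]; first by exists (PConst x).
  by exists (PVar F k).
have /choice[q qP] : forall i, exists q, pwf B n q /\ pev id s q = (c *: p)`_i.
  by move=> i; have [q qA qx] := cp i; exists q.
exists [seq q i | i <- iota 0 (size p)].
have -> : Poly [seq pev id s e | e <- [seq q i | i <- iota 0 (size p)]] = c *: p.
  apply/polyP => i; rewrite coef_Poly -map_comp.
  have [ip|ip] := ltnP i (size p).
    by rewrite (nth_map 0%N) ?size_iota // nth_iota //=; have [] := qP i.
  by rewrite coefZ !nth_default ?mulr0 // size_map size_iota.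
split; last by rewrite /root hornerZ (rootP pn) mulr0.
  move=> e /List.in_map_iff[i [<- _]]; by have [] := qP i.
by rewrite scaler_eq0 negb_or c0.
Qed.

End PolynomialExpressions.

(** * Avoiding roots by a greedy choice of digits *)

Section Greedy.
Variables (R : realType) (F : valuedFieldType R) (cF : GRing.closed_field_axiom F).
Variables (th : R) (m : nat) (ga : (nat -> bool) -> F).
Hypothesis th01 : 0 < th < 1.
(** Down to the scale [th ^+ m], the points [ga b] are arranged as the ends of a binary tree: the
    first differing digit of two of them determines their distance. *)
Hypothesis ga_le : forall s b b', (s <= m)%N -> (forall t, (t < s)%N -> b t = b' t) ->
  absv (ga b - ga b') <= th ^+ s.
Hypothesis ga_eq : forall s b b', (s < m)%N -> (forall t, (t < s)%N -> b t = b' t) ->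
  b s != b' s -> absv (ga b - ga b') = th ^+ s.

Let th0 : 0 < th. Proof. by case/andP: th01. Qed.
Let th1 : th < 1. Proof. by case/andP: th01. Qed.
Let thX k : 0 < th ^+ k. Proof. exact: exprn_gt0. Qed.

(* The binary digits of [b] from [s] on are chosen one by one, each time so as
   to keep at most half of the remaining [r] in the ball of radius [th ^ s]. *)
Lemma greedy s b0 (rs : seq F) : (s + size rs <= m)%N ->
  exists2 b, forall t, (t < s)%N -> b t = b0 t &
    th ^+ size rs * \prod_(r <- rs) Num.max (th ^+ s) (absv (ga b0 - r)) <=
      \prod_(r <- rs) absv (ga b - r).
Proof.
have [N] := ubnP (size rs); elim: N s b0 rs => // N IH s b0 rs rsN srs.
have [->|rs0] := eqVneq rs [::]; first by exists b0; rewrite // !big_nil mulr1.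
have n0 : (0 < size rs)%N by rewrite lt0n size_eq0.
have sm : (s < m)%N by apply: leq_trans srs; rewrite -[ltnLHS]addn0 ltn_add2l.
pose bc (c : bool) t := if t == s then c else b0 t.
pose cls c := fun r => absv (ga (bc c) - r) < th ^+ s.
have bc_lt c t : (t < s)%N -> bc c t = b0 t by rewrite /bc => ts; rewrite ltn_eqF.
(* The centres are at distance [th ^+ s], so the two open balls of this radius are disjoint, and one
   of them contains at most half of [rs]. *)
have [c nc] : exists c, (2 * count (cls c) rs <= size rs)%N.
  have : (count (cls false) rs + count (cls true) rs <= size rs)%N.
    rewrite -count_predUI -[leqRHS]addn0 leq_add ?count_size // leqn0.
    rewrite -[_ == _]negbK -lt0n -has_count; apply/hasPn => r _ /=; apply/negP => /andP[n1 n2].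
    have : absv (ga (bc false) - ga (bc true)) < th ^+ s.
      by apply: (absv_lt_trans (y := r)); rewrite // absvB.
    rewrite (ga_eq (s := s)) ?ltxx // => [t ts|]; first by rewrite !bc_lt.
    by rewrite /bc eqxx.
  have [h|h] := leqP (count (cls false) rs) (count (cls true) rs) => sz.
    exists false; lia.
  by exists true; lia.
pose k := count (cls c) rs.
have [||b bbc bprod] := IH s.+1 (bc c) [seq r <- rs | cls c r].
- rewrite size_filter; move: rsN nc n0; rewrite -/k; lia.
- rewrite size_filter; move: srs nc n0; rewrite -/k; lia.
exists b => [t ts|]; first by rewrite bbc ?bc_lt // ltnW.
move: bprod; rewrite size_filter !big_filter -/k => bprod.
rewrite (bigID (cls c)) /= [leRHS](bigID (cls c)) /= mulrA.
have b_b0 t : (t < s)%N -> b t = b0 t by move=> ts; rewrite bbc ?bc_lt // ltnW.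
have kE (x : R) : \prod_(r <- rs | cls c r) x = x ^+ k by rewrite big_const_seq iter_mulr_1.
apply: ler_pM.
- by rewrite mulr_ge0 ?(ltW (thX _)) // prodr_ge0 // => r _; rewrite le_max (ltW (thX s)).
- by rewrite prodr_ge0 // => r _; rewrite le_max (ltW (thX s)).
- apply: le_trans bprod; have -> : \prod_(r <- rs | cls c r) Num.max (th ^+ s) (absv (ga b0 - r)) = (th ^+ s) ^+ k.
    rewrite -kE; apply: eq_bigr => r rc; apply/max_idPl.
    apply: (absv_le_trans (y := ga (bc c))); last exact: ltW.
    by apply: ga_le => [|t ts]; [exact: ltnW|rewrite bc_lt].
  (* As [2 * k <= size rs], the factor [th ^+ size rs] pays for the [th ^+ k] of the induction
     hypothesis and for passing from [th ^+ s] to [th ^+ s.+1] at [k] roots. *)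
  apply: (@le_trans _ _ (th ^+ k * (th ^+ s.+1) ^+ k)).
    rewrite exprS exprMn mulrA ler_wpM2r ?(ltW (exprn_gt0 _ (thX _))) // -exprD.
    by rewrite ler_wiXn2l ?(ltW th0) ?(ltW th1) //; move: nc; rewrite -/k; lia.
  rewrite ler_wpM2l ?(ltW (thX _)) // -kE; apply: ler_prod => r _.
  by rewrite le_max lexx (ltW (thX _)).
- apply: ler_prod => r /negP; rewrite /cls => /negP; rewrite -leNgt => rc.
  rewrite le_max (ltW (thX s)) /=.
  have bE : absv (ga b - r) = absv (ga (bc c) - r).
    have -> : ga b - r = (ga (bc c) - r) + (ga b - ga (bc c)) by ring.
    rewrite absv_eql //.
    apply: lt_le_trans rc; apply: le_lt_trans (ga_le (s := s.+1) sm bbc) _.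
    by rewrite exprS gtr_pMl.
  rewrite bE ge_max rc /= -bE; apply: (absv_le_trans (y := ga b)) => //.
  rewrite bE; apply: le_trans rc; apply: ga_le => [|t ts]; first exact: ltnW.
  by rewrite b_b0.
Qed.

(** With no digit fixed, [greedy] compares with [Num.max 1 (absv (ga b0 - r))], which bounds
    [absv (z - r)] for every [z] in the unit ball. *)
Lemma greedy_poly (q : {poly F}) z i : absv z <= 1 -> (forall b, absv (ga b) <= 1) ->
  (size q <= i.+1)%N -> (i <= m)%N -> exists b, th ^+ i * absv q.[z] <= absv q.[ga b].
Proof.
move=> z1 ga1 qi im; have [->|q0] := eqVneq q 0.
  by exists xpredT; rewrite !horner0 absv0 mulr0.
have [rs qE] := closed_field_split cF q0.
have szq : size q = (size rs).+1 by rewrite {1}qE size_scale ?lead_coef_eq0 // size_prod_XsubC.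
have rsi : (size rs <= i)%N by rewrite -ltnS -szq.
have [|b _ bP] := @greedy 0 xpredT rs; first by rewrite add0n (leq_trans rsi).
exists b; rewrite qE !hornerZ !absvM mulrCA ler_wpM2l ?absv_ge0 //.
rewrite !horner_prod !absv_prod; under [leRHS]eq_bigr do rewrite hornerXsubC.
apply: le_trans bP; under eq_bigr do rewrite hornerXsubC; apply: ler_pM.
- exact: ltW (thX _).
- by rewrite prodr_ge0 // => r _; exact: absv_ge0.
- by rewrite ler_wiXn2l ?(ltW th0) ?(ltW th1).
- apply: ler_prod => r _; rewrite absv_ge0 expr0 -(subrKA (ga xpredT)).
  by apply: le_trans (absv_ultra _ _) _; rewrite ge_max !le_max lexx orbT absv_leB.
Qed.

End Greedy.

(** By the ultrametric inequality, a sequence is Cauchy as soon as its consecutive differences tend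
    to 0. *)
Lemma seq_complete (R : realType) (F : analyticFieldType R) (u : nat -> F) :
  (forall e : R, 0 < e -> exists N, forall k, (N <= k)%N -> absv (u k.+1 - u k) < e) ->
  exists l, forall e : R, 0 < e -> exists N, forall k, (N <= k)%N -> absv (l - u k) < e.
Proof.
move=> du.
have uN e : 0 < e -> exists N, forall k, (N <= k)%N -> absv (u N - u k) < e.
  move=> e0; have [N NP] := du e e0; exists N => k.
  elim: k => [|k IH]; first by rewrite leqn0 => /eqP->; rewrite subrr absv0.
  rewrite leq_eqVlt => /predU1P[<-|Nk]; first by rewrite subrr absv0.
  by apply: (absv_lt_trans (y := u k)); [exact: IH|rewrite absvB NP].
have uC : cauchy (u @ \oo).
  apply/cauchy_ballP => e e0 /=; have [N NP] := uN e e0.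
  exists (u @` [set k | (N <= k)%N], u @` [set k | (N <= k)%N]).
    by split; exists N => // k /= Nk; exists k.
  move=> [_ _] [/= [k Nk <-] [l Nl <-]]; rewrite ball_absvE /=.
  by apply: (absv_lt_trans (y := u N)); [rewrite absvB|]; exact: NP.
have ul : cvg (u @ \oo) by exact: (@cauchy_cvg F).
exists (lim (u @ \oo)) => e e0.
have [N _ NP] := ul _ (nbhsx_ballx (lim (u @ \oo)) e e0).
by exists N => k /NP /=; rewrite ball_absvE.
Qed.

(** * Slopes with binary digits *)

Section Slopes.
Variables (R : realType) (F : analyticFieldType R).
Variables (v g : F).
Hypotheses (v01 : 0 < absv v < 1) (gv : absv g < absv v).

Let th := absv v.
Let v1 : absv v <= 1. Proof. by apply: ltW; case/andP: v01. Qed.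

Definition digits m (b : nat -> bool) (w : F) : F := \sum_(s < m) (b s)%:R * w ^+ s.

Lemma absv_bool (b : bool) : absv (b%:R : F) = b%:R.
Proof. by case: b; rewrite ?absv0 ?absv1. Qed.

Lemma digits_le m b w : absv w <= 1 -> absv (digits m b w) <= 1.
Proof.
move=> w1; apply: absv_sum_le => // s _; rewrite absvM absvX absv_bool.
by rewrite mulr_ile1 ?exprn_ge0 ?exprn_ile1 ?absv_ge0 ?ler0n // lern1 leq_b1.
Qed.

Lemma digits_lip m b w w' : absv w <= 1 -> absv w' <= 1 ->
  absv (digits m b w - digits m b w') <= absv (w - w').
Proof.
move=> w1 w'1; rewrite /digits -sumrB; apply: absv_sum_le => [|s _]; first exact: absv_ge0.
rewrite -mulrBr absvM absv_bool.
have : absv (w ^+ s - w' ^+ s) <= absv (w - w').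
  rewrite subrXX absvM ler_piMr ?absv_ge0 //; apply: absv_sum_le => // i _.
  by rewrite absvM !absvX mulr_ile1 ?exprn_ge0 ?exprn_ile1 ?absv_ge0.
by case: (b s); rewrite ?mul1r // mul0r absv_ge0.
Qed.

(** [w] is the fixed point of [Phi], which contracts the unit ball by the factor [absv g], because
    [digits] is 1-Lipschitz there. *)
Lemma slope_exists m b : exists w, [/\ v = w + digits m b w * g, absv w = absv v &
  absv (v - w) <= absv g].
Proof.
pose Phi w := v - digits m b w * g.
have Phi_v w : absv w <= 1 -> absv (Phi w - v) <= absv g.
  move=> w1; rewrite /Phi addrC addKr absvN absvM ler_piMl ?absv_ge0 //.
  exact: digits_le.
have Phi1 w : absv w <= 1 -> absv (Phi w) <= 1.
  move=> w1; rewrite -(subrK v (Phi w)); apply: absv_le => //.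
  exact: le_trans (Phi_v _ w1) (le_trans (ltW gv) _).
have Phi_lip w w' : absv w <= 1 -> absv w' <= 1 -> absv (Phi w - Phi w') <= absv g * absv (w - w').
  move=> w1 w'1; rewrite /Phi.
  have -> : v - digits m b w * g - (v - digits m b w' * g) = g * (digits m b w' - digits m b w) by ring.
  by rewrite absvM ler_wpM2l ?absv_ge0 // [leRHS]absvB digits_lip.
pose u k := iter k Phi v.
have u1 k : absv (u k) <= 1 by elim: k => //= k; exact: Phi1.
have g1 : 0 <= absv g < 1 by rewrite absv_ge0 (lt_le_trans gv).
have du k : absv (u k.+1 - u k) <= absv g ^+ k.+1.
  elim: k => [|k IH]; first by rewrite expr1 Phi_v.
  rewrite exprS; apply: le_trans (Phi_lip (u k.+1) (u k) (u1 _) (u1 _)) _.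
  by rewrite ler_wpM2l ?absv_ge0.
have [w wP] : exists w, forall e : R, 0 < e -> exists N, forall k, (N <= k)%N -> absv (w - u k) < e.
  apply: seq_complete => e e0; have [N NP] := exprn_lt_small g1 e0.
  exists N => k Nk; apply: le_lt_trans (du k) _; apply: le_lt_trans NP.
  by apply: ler_wiXn2l; rewrite ?absv_ge0 ?ltW ?leqW //; case/andP: g1.
have w1 : absv w <= 1.
  have [N NP] := wP 1 ltr01; rewrite -(subrK (u N) w); apply: absv_le => //.
  exact/ltW/NP.
have Phiw : Phi w = w.
  apply/eqP; rewrite -subr_eq0 -absv_eq0b eq_le absv_ge0 andbT.
  apply/ler_addgt0Pr => e e0; rewrite add0r; have [N NP] := wP e e0.
  rewrite -(subrKA (u N.+1)); apply: absv_le.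
    apply: le_trans (Phi_lip w (u N) w1 (u1 N)) _.
    apply: (@le_trans _ _ (absv (w - u N))); last by apply/ltW/NP.
    by rewrite ler_piMl ?absv_ge0 // ltW //; case/andP: g1.
  by rewrite absvB; apply/ltW/NP.
exists w; split.
- by rewrite -{1}Phiw /Phi subrK.
- rewrite -{1}Phiw -[Phi w](subrK v) addrC absv_eql //.
  by apply: le_lt_trans gv; exact: Phi_v.
- by rewrite -{1}Phiw absvB; exact: Phi_v.
Qed.

(* The slopes [ga b] are polynomials in the point [w b] where the line of slope
   [ga b] through [(v, g)] meets the first axis, so they are constant along
   that line as functions over the field generated by [w b]. *)
Lemma slopes m : exists ga : (nat -> bool) -> F,
  [/\ forall b, absv (ga b) <= 1,
    forall b, exists w, [/\ v = w + ga b * g, absv (v - w) <= absv g &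
      exists p : {poly int}, ga b = (map_poly intr p).[w]],
    forall s b b', (s <= m)%N -> (forall t, (t < s)%N -> b t = b' t) ->
      absv (ga b - ga b') <= th ^+ s
  & forall s b b', (s < m)%N -> (forall t, (t < s)%N -> b t = b' t) ->
      b s != b' s -> absv (ga b - ga b') = th ^+ s].
Proof.
have /choice[w wP] := slope_exists m.
have w1 b : absv (w b) <= 1 by have [_ -> _] := wP b.
exists (fun b => digits m b (w b)).
have tail s b b' : (s <= m)%N -> (forall t, (t < s)%N -> b t = b' t) ->
    digits m b (w b') - digits m b' (w b') =
    \sum_(s <= t < m) ((b t)%:R - (b' t)%:R) * w b' ^+ t.
  move=> sm bb; rewrite /digits -sumrB -(big_mkord xpredT (fun t => (b t)%:R * w b' ^+ t - (b' t)%:R * w b' ^+ t)).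
  rewrite (big_cat_nat (leq0n s) sm) //= big_nat_cond big1 ?add0r => [|t /andP[/bb-> _]]; last first.
    by rewrite subrr.
  by apply: eq_bigr => t _; rewrite mulrBl.
have absv_diff (c d : bool) : absv (c%:R - d%:R : F) <= 1.
  by case: c d => -[]; rewrite ?subrr ?subr0 ?sub0r ?absvN ?absv0 ?absv1.
(* Since [w b] and [w b'] differ by [g * D], evaluating both digit sums at [w b'] changes their
   difference [D] by at most [absv g * absv D], which does not affect its absolute value. *)
have tailE s b b' : (s <= m)%N -> (forall t, (t < s)%N -> b t = b' t) ->
    absv (digits m b (w b) - digits m b' (w b')) =
    absv (\sum_(s <= t < m) ((b t)%:R - (b' t)%:R) * w b' ^+ t).
  move=> sm bb; rewrite -tail //.
  set D := digits m b (w b) - _; set T := digits m b (w b') - _.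
  have wE c : w c = v - digits m c (w c) * g by have [vc _ _] := wP c; rewrite {1}vc addrK.
  have wD : w b - w b' = - (g * D).
    transitivity ((v - digits m b (w b) * g) - (v - digits m b' (w b') * g)).
      by rewrite -!wE.
    by rewrite /D; ring.
  have DT : absv (D - T) <= absv g * absv D.
    have -> : D - T = digits m b (w b) - digits m b (w b') by rewrite /D /T; ring.
    by apply: le_trans (digits_lip _ _ (w1 _) (w1 _)) _; rewrite wD absvN absvM.
  have [D0|D0] := eqVneq D 0.
    move: DT; rewrite D0 absv0 mulr0 sub0r absvN => T0.
    by apply/eqP; rewrite eq_le T0 absv_ge0.
  apply/esym; transitivity (absv (D + (T - D))); first by congr absv; ring.
  apply: absv_eql; rewrite absvB; apply: le_lt_trans DT _.
  by rewrite gtr_pMl ?absv_gt0 // (lt_le_trans gv).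
have thE b : absv (w b) = th by have [_ -> _] := wP b.
have thX i j : (i <= j)%N -> th ^+ j <= th ^+ i.
  by move=> ij; rewrite ler_wiXn2l ?absv_ge0.
split.
- by move=> b; exact: digits_le.
- move=> b; have [vb _ vw] := wP b; exists (w b); split=> //.
  exists (\poly_(s < m) (b s)%:R).
  rewrite (horner_coef_wide (n := m)); last first.
    exact: leq_trans (size_poly _ _) (size_poly _ _).
  apply: eq_bigr => s _; rewrite coef_map coef_poly ltn_ord /=.
  by rewrite rmorph_nat.
- move=> s b b' sm bb; rewrite (tailE s) // big_nat_cond; apply: absv_sum_le.
    by rewrite exprn_ge0 // absv_ge0.
  move=> t; rewrite andbT => /andP[st _]; rewrite absvM absvX thE.
  apply: (le_trans _ (thX _ _ st)); rewrite ler_piMl ?exprn_ge0 ?absv_ge0 //.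
- move=> s b b' sm bb bs; rewrite (tailE s b b' (ltnW sm) bb) big_ltn //.
  have b1 : absv ((b s)%:R - (b' s)%:R : F) = 1.
    by case: (b s) (b' s) bs => -[]; rewrite // ?subr0 ?sub0r ?absvN absv1.
  have th0 : 0 < th by case/andP: v01.
  have th1 : th < 1 by case/andP: v01.
  rewrite absv_eql absvM absvX thE b1 mul1r // big_nat_cond.
  apply: absv_sum_lt => [|t]; first exact: exprn_gt0.
  rewrite andbT => /andP[st _]; rewrite absvM absvX thE.
  apply: (@le_lt_trans _ _ (th ^+ t)); last by rewrite ltr_iXn2l.
  by rewrite ler_piMl ?exprn_ge0 ?absv_ge0.
Qed.

End Slopes.

(* Contains the polynomials [Q(ZY, Y)], seen as polynomials in [Y] over the
   polynomials in [Z]. *)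
Definition triangular (F : nzRingType) : set {poly {poly F}} :=
  [set p : {poly {poly F}} | forall i, (size (p`_i)%R <= i.+1)%N].

Lemma triangular_subring (F : nzRingType) : subring (@triangular F).
Proof.
split.
- move=> i; rewrite coef1; case: i => [|i] /=; first by rewrite size_poly1.
  by rewrite size_poly0.
- move=> p q pt qt i; rewrite coefB (leq_trans (size_polyD _ _)) //.
  by rewrite geq_max size_polyN pt qt.
- move=> p q pt qt i; rewrite coefM (leq_trans (size_sum _ _ _)) //.
  apply/bigmax_leqP => j _; rewrite (leq_trans (size_polyMleq _ _)) //.
  have := pt j; have := qt (i - j)%N; have := ltn_ord j.
  move: (size (p`_j)%R) (size (q`_(i - j))%R) => a b; lia.
Qed.

(** * Restriction of a relation to lines *)

Section Lines.
Variables (R : realType) (F : valuedFieldType R) (cF : GRing.closed_field_axiom F).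
Implicit Types (P : pexp F) (v z : nat -> F).

(* Variable [0] of a polynomial expression stands for [g], variable [i.+1] for
   [v i]. *)
Definition line (g : F) v z (i : nat) : {poly F} :=
  if i is i'.+1 then (v i')%:P + (z i')%:P * 'X else g%:P + 'X.

Definition restrict P g v z : {poly F} := pev polyC (line g v z) P.

Definition set_slope z (k : nat) (c : F) i := if i == k then c else z i.

(** The slope in direction [k] is an indeterminate, the inner variable; the outer variable is the
    parameter on the line. *)
Definition generic_line (g : F) v z k (i : nat) : {poly {poly F}} :=
  if i is i'.+1 then (v i')%:P%:P + (if i' == k then 'X%:P else (z i')%:P%:P) * 'X
  else g%:P%:P + 'X.

(** In the expansion of [Q] in the parameter, the coefficient of degree [i] has degree at most [i]
    in the slope; in particular the constant one does not depend on it. By [greedy_poly] some good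
    slope diminishes the coefficient of degree [i] by at most [th ^+ i], which the Newton criterion
    absorbs when [r] becomes [r / th]. *)
Lemma change_slope P B n g v z k (r th : R) (Good : F -> Prop) :
  pwf B n P -> 0 < r -> 0 < th < 1 -> absv (z k) <= 1 ->
  (forall m, exists ga : (nat -> bool) -> F,
    [/\ forall b, absv (ga b) <= 1, forall b, Good (ga b),
      forall s b b', (s <= m)%N -> (forall t, (t < s)%N -> b t = b' t) ->
        absv (ga b - ga b') <= th ^+ s
    & forall s b b', (s < m)%N -> (forall t, (t < s)%N -> b t = b' t) ->
        b s != b' s -> absv (ga b - ga b') = th ^+ s]) ->
  restrict P g v z != 0 ->
  (exists2 y, root (restrict P g v z) y & absv y < r) ->
  exists c, [/\ Good c, absv c <= 1, restrict P g v (set_slope z k c) != 0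
    & exists2 y, root (restrict P g v (set_slope z k c)) y & absv y < r / th].
Proof.
move=> PB r0 /andP[th0 th1] zk Hga G0 [y Gy yr].
pose Q := pev (fun c : F => c%:P%:P) (generic_line g v z k) P.
have QE c : map_poly (horner_eval c) Q = restrict P g v (set_slope z k c).
  apply: pev_morph => [d|[|i]] /=.
  - by rewrite map_polyC /= /horner_eval hornerC.
  - by rewrite rmorphD /= map_polyX map_polyC /= /horner_eval hornerC.
  rewrite rmorphD rmorphM /= map_polyX /set_slope.
  by case: eqP => _; rewrite !map_polyC /= /horner_eval ?hornerX !hornerC.
have zE : z = set_slope z k (z k).
  by apply/funext => i; rewrite /set_slope; case: eqP => [->|].
have Qtri : triangular Q.
  apply: (pev_subring (D := @triangular F) (@triangular_subring F) _ _ PB).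
    move=> c _ i; rewrite !coefC; case: i => [|i] /=; first exact: size_polyC_leq1.
    by rewrite size_poly0.
  have Xt : triangular ('X : {poly {poly F}}).
    by move=> i; rewrite coefX; case: i => [|[|i]]; rewrite /= ?size_poly0 ?size_poly1.
  have Ct c : triangular (c%:P%:P : {poly {poly F}}).
    move=> i; rewrite !coefC; case: i => [|i] /=; first exact: size_polyC_leq1.
    by rewrite size_poly0.
  case=> [_|i _] /=; apply: (subringD (@triangular_subring F)) => //.
  case: eqP => _; last exact: (subringM (@triangular_subring F)).
  move=> [|[|l]]; rewrite coefMX /= ?coefC /= ?size_poly0 ?size_polyX //.
have QcE c i : (map_poly (horner_eval c) Q)`_i = (Q`_i).[c].
  by rewrite coef_map_id0 /horner_eval ?horner0.
have [i i0] := newton_coef G0 Gy yr; rewrite {1 2}zE -QE !QcE => Qi.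
have iQ : (i <= size Q)%N.
  rewrite leqNgt; apply/negP => /ltnW Qsi; move: Qi.
  by rewrite [Q`_i]nth_default // horner0 absv0 mul0r ltNge absv_ge0.
have [ga [ga1 gaG ga_le ga_eq]] := Hga (size Q).
have [b gab] := greedy_poly cF (introT andP (conj th0 th1)) ga_le ga_eq zk ga1 (Qtri i) iQ.
exists (ga b); split=> //; rewrite -QE.
  apply/eqP => /polyP/(_ i); rewrite coef0 QcE => Q0; move: gab.
  rewrite Q0 absv0 pmulr_rle0 ?exprn_gt0 // => Qz; move: Qi; apply/negP; rewrite -leNgt.
  by apply: le_trans (absv_ge0 _); rewrite mulr_le0_ge0 // exprn_ge0 // ltW.
apply: (newton_root cF i0); first exact: divr_gt0.
rewrite !QcE; have -> : (Q`_0).[ga b] = (Q`_0).[z k].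
  by have := Qtri 0%N => /size1_polyC ->; rewrite !hornerC.
apply: lt_le_trans Qi _; rewrite expr_div_n mulrA ler_pdivlMr ?exprn_gt0 //.
by rewrite mulrAC ler_wpM2r ?(exprn_ge0 _ (ltW r0)) // mulrC.
Qed.

End Lines.

(** * Compression to n generators *)

Lemma subfield_nat (F : fieldType) (A : set F) n : subfield A -> A n%:R.
Proof.
move=> sA; elim: n => [|n IH]; first exact: subfield0.
by rewrite -addn1 natrD; apply: subfieldD => //; case: sA.
Qed.

Lemma subfield_int (F : fieldType) (A : set F) (m : int) : subfield A -> A m%:~R.
Proof.
move=> sA; case: m => n; first exact: subfield_nat.
by rewrite NegzE mulrNz; apply: subfieldN => //; exact: subfield_nat.
Qed.

Section Compression.
Variables (R : realType) (F : analyticFieldType R) (W : valuedFieldType R).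
Variables (cW : GRing.closed_field_axiom W) (j : {rmorphism F -> W}).
Hypothesis jabs : absv_preserving j.
Implicit Types (B : set W) (v w : nat -> F) (g : F).

(** The line of slope [c] through [(j g, j v)] meets the axis where the first coordinate is 0 at
    [j w]; the last condition makes this line defined over the field generated by [j w]. *)
Definition good_slope (v g : F) (c : W) := exists w : F, [/\ j v = j w + c * j g,
  absv (v - w) <= absv g & gen [set j w] c].

Lemma good_slopes (v g : F) m : 0 < absv v < 1 -> absv g < absv v ->
  exists ga : (nat -> bool) -> W,
    [/\ forall b, absv (ga b) <= 1, forall b, good_slope v g (ga b),
      forall s b b', (s <= m)%N -> (forall t, (t < s)%N -> b t = b' t) ->
        absv (ga b - ga b') <= absv v ^+ s
    & forall s b b', (s < m)%N -> (forall t, (t < s)%N -> b t = b' t) ->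
        b s != b' s -> absv (ga b - ga b') = absv v ^+ s].
Proof.
move=> v01 gv; have [ga [ga1 gaw ga_le ga_eq]] := slopes v01 gv m.
exists (fun b => j (ga b)); split=> [b|b|s b b' sm bb|s b b' sm bb bs].
- by rewrite jabs.
- have [w [vw wv [p gap]]] := gaw b; exists w; split=> //.
    by rewrite {1}vw rmorphD rmorphM.
  rewrite gap -horner_map -map_poly_comp; apply: (@subring_horner _ (gen [set j w])).
  + exact/subfield_subring/gen_subfield.
  + move=> i; rewrite coef_map_id0 /= ?rmorph0 // rmorph_int.
    by apply: subfield_int; exact: gen_subfield.
  + exact: gen_incl.
- by rewrite -rmorphB jabs ga_le.
- by rewrite -rmorphB jabs (ga_eq s).
Qed.

(** The slopes are made good one after the other, each at the cost of a factor [th] in the distance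
    to the zero. *)
Lemma good_slopes_root B n P g v (z : nat -> W) (th r : R) m :
  pwf B n P -> (forall i, absv (v i) = th) -> 0 < th < 1 -> absv g < th -> 0 < r ->
  (forall i, absv (z i) <= 1) -> restrict P (j g) (j \o v) z != 0 ->
  (exists2 y, root (restrict P (j g) (j \o v) z) y & absv y < r) ->
  exists c, [/\ forall i, (i < m)%N -> good_slope (v i) g (c i),
    forall i, absv (c i) <= 1, restrict P (j g) (j \o v) c != 0
    & exists2 y, root (restrict P (j g) (j \o v) c) y & absv y < r / th ^+ m].
Proof.
move=> PB vth th01 gth r0 z1 G0 Gy; have /andP[th0 _] := th01.
elim: m => [|m [c [cG c1 H0 Hy]]]; first by exists z; split=> //; rewrite expr0 divr1.
have rm : 0 < r / th ^+ m by rewrite divr_gt0 ?exprn_gt0.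
have good k : exists ga : (nat -> bool) -> W,
    [/\ forall b, absv (ga b) <= 1, forall b, good_slope (v m) g (ga b),
      forall s b b', (s <= k)%N -> (forall t, (t < s)%N -> b t = b' t) ->
        absv (ga b - ga b') <= th ^+ s
    & forall s b b', (s < k)%N -> (forall t, (t < s)%N -> b t = b' t) ->
        b s != b' s -> absv (ga b - ga b') = th ^+ s].
  by rewrite -(vth m); apply: good_slopes; rewrite vth.
have [d [dG d1 D0 Dy]] := change_slope cW PB rm th01 (c1 m) good H0 Hy.
exists (set_slope c m d); split=> //.
- move=> i im; rewrite /set_slope; case: eqP => [->//|/eqP im'].
  by apply: cG; rewrite ltn_neqAle im' -ltnS.
- by move=> i; rewrite /set_slope; case: eqP.
- by rewrite exprSr invfM mulrA.
Qed.

(* By Steinitz, the approximants in the closure of [xs] to [g] and to the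
   [v i] satisfy a polynomial relation, which has a zero on a line through
   the point [(g, v)]. *)
Lemma relation_on_line B (xs : seq W) v g (r : R) : subfield B ->
  range j `<=` ac (B `|` lset xs) -> 0 < absv (v 0%N) < 1 -> 0 < r ->
  (exists2 a, cl B a & absv (j g - a) < r) \/
  exists k P z, [/\ (k <= size xs)%N, pwf B k.+1 P, forall i, absv (z i) <= 1,
    restrict P (j g) (j \o v) z != 0 &
    exists2 y, root (restrict P (j g) (j \o v) z) y & absv y < r].
Proof.
move=> sB jac /andP[t0 t1] r0; set n := size xs.
(* A small nonzero [u] moves the approximant of [j g] away from [j g] if they coincide, since
   [y0 - j g] is a denominator below. *)
have [u [cu u0 ur]] : exists u, [/\ cl (B `|` lset xs) u, u != 0 & absv u < r].
  have [N tN] : exists N, absv (v 0%N) ^+ N < r by apply: exprn_lt_small; rewrite ?ltW.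
  have tN0 : 0 < absv (j (v 0%N ^+ N)) by rewrite jabs absvX exprn_gt0.
  have [|u cu tu] := jac (j (v 0%N ^+ N)) _ _ tN0; first by exists (v 0%N ^+ N).
  exists u; have uE : absv u = absv (j (v 0%N ^+ N)).
    by rewrite -[u](subrKC (j (v 0%N ^+ N))) absv_eql // absvB.
  by split=> //; rewrite -?absv_gt0 uE // jabs absvX.
have [y0 [cy0 y0g y0r]] : exists y0, [/\ cl (B `|` lset xs) y0, y0 != j g & absv (y0 - j g) < r].
  have [|y cy gy] := jac (j g) _ r r0; first by exists g.
  have [yg|yg] := eqVneq y (j g); last by exists y; split=> //; rewrite absvB.
  exists (y + u); rewrite yg addrC addrK; split=> //; last by rewrite -subr_eq0 addrK.
  by rewrite -yg; apply: subfieldD => //; exact: cl_subfield.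
pose Y0 := y0 - j g; have Y00 : Y0 != 0 by rewrite subr_eq0.
have aY0 : 0 < absv Y0 by rewrite absv_gt0.
have /choice[vt vtP] : forall i, exists u, cl (B `|` lset xs) u /\ absv (j (v i) - u) < absv Y0.
  move=> i; have [|u' cu' vu'] := jac (j (v i)) _ _ aY0; first by exists (v i).
  by exists u'.
pose s i := if i is i'.+1 then vt i' else y0.
(* [y0] and the first [n] of the [vt i] are [n + 1] elements dependent on [n] ones, so one of them
   depends on its predecessors. If it is [y0], the first alternative holds. *)
have [k kn ck] : exists2 k, (k <= n)%N & cl (B `|` s @` `I_k) (s k).
  apply: contrapT => nk.
  have : (size (mkseq s n.+1) <= n)%N.
    apply: (steinitz (S := B)) => [y /mapP[i _ ->]|i].
      by case: i => [|i] //=; have [] := vtP i.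
    rewrite size_mkseq => iN; rewrite nth_mkseq // => ci; apply: nk; exists i => //.
    apply: cl_mono ci => y [By|yt]; [by left|right].
    have it : size (take i (mkseq s n.+1)) = i by rewrite size_takel // size_mkseq ltnW.
    have [l] := nthP 0 yt; rewrite it => li <-; exists l => //.
    by rewrite nth_take // nth_mkseq // (ltn_trans li).
  by rewrite size_mkseq ltnn.
case: k kn ck => [|k] kn ck.
  left; exists y0; last by rewrite absvB.
  by apply: cl_mono ck => y [//|[i]]; rewrite /= ltn0.
right; have [es [esB q0 qs]] := cl_relation sB ck.
pose P := phorner k.+1 es; set q := Poly _ in q0 qs.
have PB : pwf B k.+2 P by exact: pwf_horner.
(* These slopes give the line through [(j g, j v)] and [(y0, vt)], which reaches the latter at the
   parameter [Y0]. They are at most 1 because each [vt i] is within [absv Y0] of [j (v i)]. *)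
pose z i := (vt i - j (v i)) / Y0.
have z1 i : absv (z i) <= 1.
  rewrite absvM absvV ler_pdivrMr // mul1r absvB; apply: ltW.
  by have [] := vtP i.
have evE c y : (restrict P (j g) (j \o v) c).[y] =
    pev id (fun i => (line (j g) (j \o v) c i).[y]) P.
  by rewrite -[LHS]/(horner_eval y _); apply: pev_morph => // d; rewrite /= /horner_eval hornerC.
have lineE c i : (line (j g) (j \o v) c i.+1).[Y0] = j (v i) + c i * Y0.
  by rewrite /line !hornerE.
have line0 c : (line (j g) (j \o v) c 0).[Y0] = y0.
  by rewrite /line hornerD hornerC hornerX subrKC.
have sE i : (line (j g) (j \o v) z i).[Y0] = s i.
  by case: i => [|i]; [rewrite line0|rewrite lineE /z divfK // subrKC].
have zY0 : root (restrict P (j g) (j \o v) z) Y0.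
  rewrite /root evE (_ : (fun i => _) = s); last by apply/funext.
  by rewrite (pev_horner idfun) -/q.
(* If [P] vanishes on the whole line, the line is tilted in the direction of the last variable of
   [P]. Among enough powers of [j (v 0)], one is a slope for which [P] is nonzero at [Y0]; the zero
   at the parameter 0 remains. *)
have [G0|G0] := eqVneq (restrict P (j g) (j \o v) z) 0; last first.
  by exists k.+1, P, z; split=> //; exists Y0.
have [c c1 qc] : exists2 c, absv c <= 1 & q.[j (v k) + c * Y0] != 0.
  pose cs := [seq j (v 0%N) ^+ i | i <- iota 0 (size q)].
  have vinj a b : j (v 0%N) ^+ a = j (v 0%N) ^+ b -> a = b.
    move=> /(congr1 absv); rewrite !absvX jabs => ab.
    have [ab'|ba'|//] := ltngtP a b.
      by have := ltr_iXn2l t0 t1 b a; rewrite ab' ab ltxx.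
    by have := ltr_iXn2l t0 t1 a b; rewrite ba' ab ltxx.
  have : ~~ all (root q) [seq j (v k) + c * Y0 | c <- cs].
    have uq : uniq [seq j (v k) + c * Y0 | c <- cs].
      rewrite map_inj_uniq; last by move=> a b /addrI /(mulIf Y00).
      by rewrite map_inj_in_uniq ?iota_uniq // => a b _ _; exact: vinj.
    by apply/negP => aq; have := max_poly_roots q0 aq uq; rewrite !size_map size_iota ltnn.
  move=> /allPn[_ /mapP[c /mapP[i _ ->] ->] qc]; exists (j (v 0%N) ^+ i) => //.
  by rewrite absvX jabs exprn_ile1 ?ltW.
exists k.+1, P, (set_slope z k c); split=> //.
- by move=> i; rewrite /set_slope; case: eqP.
- apply: contraNneq qc => H0.
  have := evE (set_slope z k c) Y0; rewrite H0 horner0 (pev_horner idfun) lineE.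
  rewrite /set_slope eqxx => /esym/eqP; rewrite /q.
  suff -> : [seq pev idfun (fun i => (line (j g) (j \o v) (set_slope z k c) i).[Y0]) e | e <- es]
      = [seq pev id s e | e <- es] by [].
  apply: List.map_ext_in => e /esB eB; apply: (eq_pev _ eB) => -[|i] ik //.
  by rewrite -sE !lineE /set_slope ltn_eqF.
- exists 0; last by rewrite absv0.
  have z0 : pev id (fun i => (line (j g) (j \o v) z i).[0]) P = 0 by rewrite -evE G0 horner0.
  rewrite /root evE -[X in _ == X]z0; apply/eqP; congr pev; apply/funext => -[|i] //=.
  by rewrite !hornerE.
Qed.

Lemma compression B (xs : seq W) v g (th d : R) : subfield B ->
  range j `<=` ac (B `|` lset xs) -> (forall i, absv (v i) = th) -> 0 < th < 1 ->
  absv g < th -> 0 < d ->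
  exists w : nat -> F, (forall i, absv (v i - w i) <= absv g) /\
    exists2 a, cl (B `|` (j \o w) @` `I_(size xs)) a & absv (j g - a) < d.
Proof.
move=> sB jac vth th01 gth d0; set n := size xs.
have v01 : 0 < absv (v 0%N) < 1 by rewrite vth.
(* The factor [th ^+ n] anticipates the loss in [good_slopes_root]. *)
have /andP[th0 _] := th01; pose r := d * th ^+ n.
have r0 : 0 < r by rewrite mulr_gt0 // exprn_gt0.
have [[a Ba ga]|[k [P [z [kn PB z1 G0 Gy]]]]] := relation_on_line g sB jac v01 r0.
  exists v; split=> [i|]; first by rewrite subrr absv0 absv_ge0.
  exists a; first by apply: cl_mono Ba; left.
  by apply: (lt_le_trans ga); rewrite /r ler_piMr ?(ltW d0) // exprn_ile1 // ltW //; case/andP: th01.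
have [c [cG _ H0 [y Hy yr]]] := good_slopes_root n PB vth th01 gth r0 z1 G0 Gy.
have /choice[w wP] : forall i, exists w : F, absv (v i - w) <= absv g /\
    ((i < n)%N -> j (v i) = j w + c i * j g /\ gen [set j w] (c i)).
  move=> i; have [ni|ni] := ltnP i n.
    by have [w [vw wv gw]] := cG i ni; exists w; split=> // _.
  by exists (v i); rewrite subrr absv0 absv_ge0.
exists w; split=> [i|]; first by have [] := wP i.
(* [l] parametrises the line by its first coordinate. For [i < n], [j (v i) - c i * j g] is
   [j (w i)], so the restriction [S] of [P] has coefficients in the field generated by [B] and the
   [j (w i)]. *)
pose l i := if i is i'.+1 then (j (v i') - c i' * j g)%:P + (c i')%:P * 'X else 'X.
pose S := pev polyC l P.
have SE : S \Po ('X + (j g)%:P) = restrict P (j g) (j \o v) c.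
  rewrite /S; rewrite -[LHS]/(comp_poly ('X + (j g)%:P) (pev polyC l P)).
  apply: pev_morph => [e|[|i]] /=; first by rewrite comp_polyC.
    by rewrite comp_polyX addrC.
  rewrite comp_polyD comp_polyM !comp_polyC comp_polyX rmorphB rmorphM /=.
  by ring.
set E := gen (B `|` (j \o w) @` `I_n).
have SO : over E S.
  have sE : subring E by exact/subfield_subring/gen_subfield.
  have sO := over_subring sE.
  apply: (pev_subring sO _ _ PB) => [e Be|[|i] ik].
  - by apply: (overC sE); apply: gen_incl; left.
  - exact: (overX sE).
  have ni : (i < n)%N by exact: leq_trans kn.
  have [_ /(_ ni)[vw cw]] := wP i.
  have Ec : E (c i).
    by apply: gen_mono cw => _ ->; right; exists i.
  apply: (subringD sO); last by apply: (subringM sO); [exact: (overC sE)|exact: (overX sE)].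
  by apply: (overC sE); rewrite vw addrK; apply: gen_incl; right; exists i.
exists (y + j g); last first.
  by rewrite opprD addrCA subrr addr0 absvN; move: yr; rewrite /r mulfK // lt0r_neq0 ?exprn_gt0.
exists S; split=> //.
  by apply: contraNneq H0 => S0; rewrite -SE S0 comp_poly0.
by move: Hy; rewrite -SE /root horner_comp !hornerE.
Qed.

End Compression.

(** * Generic tuples *)

Section Genericity.
Variables (R : realType) (F : analyticFieldType R) (W : valuedFieldType R).
Variables (cW : GRing.closed_field_axiom W) (j : {rmorphism F -> W}).
Hypothesis jabs : absv_preserving j.
Variables (B : set W) (xs : seq W).
Hypotheses (sB : subfield B) (jac : range j `<=` ac (B `|` lset xs)).

Let n := size xs.

Definition approximates (y : F) (e : R) (w : nat -> F) : Prop :=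
  exists2 a, cl (B `|` (j \o w) @` `I_n) a & absv (j y - a) < e.

(** [compression] moves the tuple by at most the size of the element to be approximated, so it is
    applied to a high power of [y]. An [N]-th root of the approximant then approximates [y], and
    [cl_open] extends this to a ball. *)
Lemma approximates_dense (y : F) (e th r : R) v : 0 < absv y < 1 -> 0 < e ->
  0 < th < 1 -> 0 < r -> (forall i, absv (v i) = th) ->
  exists v' r', [/\ forall i, absv (v i - v' i) < r, forall i, absv (v' i) = th,
    0 < r' <= r / 2 &
    forall w, (forall i, (i < n)%N -> absv (v' i - w i) < r') -> approximates y e w].
Proof.
move=> /andP[y0 y1] e0 th01 r0 vth; have /andP[th0 th1] := th01.
have m0 : 0 < Num.min r th by rewrite lt_min r0.
have [N' yN'] : exists N, absv y ^+ N < Num.min r th.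
  by apply: exprn_lt_small => //; rewrite y1 ltW.
pose N := N'.+1; have yN : absv (y ^+ N) < Num.min r th.
  by apply: le_lt_trans yN'; rewrite absvX ler_wiXn2l // ltW.
have {yN'} [yNr yNth] : absv (y ^+ N) < r /\ absv (y ^+ N) < th.
  by move: yN; rewrite lt_min => /andP.
have eN : 0 < e ^+ N by exact: exprn_gt0.
have [w [vw [a Ba ya]]] := compression cW jabs sB jac vth th01 yNth eN.
have wth i : absv (w i) = th.
  rewrite -(vth i) -[w i](subrKC (v i)) absv_eql // absvB.
  by apply: le_lt_trans (vw i) _; rewrite vth.
have [b pb yb] : exists2 b, root ('X^N - a%:P) b & absv (j y - b) < e.
  apply: root_near => //; rewrite ?monicXnsubC ?size_XnsubC ?(ltW e0) //.
  by rewrite !hornerE -rmorphXn.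
have Bb : cl (B `|` (j \o w) @` `I_n) b.
  apply: (alg_root (t := a) (n := N)) => //; [exact: cl_subfield|exact: cl_alg|].
  by move: pb; rewrite /root !hornerE subr_eq0 => /eqP.
have [d d0 dP] := cl_open cW Bb e0.
exists w, (Num.min d (r / 2)); split=> //.
- by move=> i; exact: le_lt_trans yNr.
- by rewrite lt_min d0 divr_gt0 //= ge_min lexx orbT.
- move=> w' ww'; have [|b' Bb' bb'] := dP (j \o w').
    move=> i ni /=; rewrite -rmorphB jabs; apply: lt_le_trans (ww' i ni) _.
    by rewrite ge_min lexx.
  by exists b' => //; apply: absv_lt_trans yb bb'.
Qed.

(** Step [k] meets the requirement [ey k] on a whole ball around the [k.+1]-st tuple; the radii are
    at least halved each time, and [w] is the limit of the tuples. *)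
Lemma generic_sequence (t : F) (y : nat -> F) : 0 < absv t < 1 ->
  (forall m, 0 < absv (y m) < 1) ->
  exists w : nat -> F, range (j \o y) `<=` ac (B `|` (j \o w) @` `I_n).
Proof.
move=> t01 y01; set th := absv t.
(* A code [k] of [(m, l)] asks to approximate [y m] within [2^-1 ^+ l]; other codes receive an
   arbitrary requirement. *)
pose ey k : R * nat := if @unpickle (nat * nat)%type k is Some (m, l) then ((2^-1) ^+ l, m) else (1, 0%N).
have e0 k : 0 < (ey k).1 :> R.
  by rewrite /ey; case: unpickle => [[m l]|] /=; rewrite ?ltr01 // exprn_gt0 // invr_gt0.
pose ok (s : (nat -> F) * R) := 0 < s.2 /\ forall i, absv (s.1 i) = th.
pose next k (s s' : (nat -> F) * R) := [/\ forall i, absv (s.1 i - s'.1 i) < s.2,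
  s'.2 <= s.2 / 2 & forall w, (forall i, (i < n)%N -> absv (s'.1 i - w i) < s'.2) ->
    approximates (y (ey k).2) (ey k).1 w].
have /choice[f fP] : forall ks : nat * ((nat -> F) * R), exists s', ok ks.2 -> ok s' /\ next ks.1 ks.2 s'.
  move=> [k [v r]] /=; have [[r0 vth]|] := pselect (ok (v, r)); last by exists (v, r).
  have [v' [r' [vv' v'th /andP[r'0 r'r] appr]]] :=
    approximates_dense (y01 (ey k).2) (e0 k) t01 r0 vth.
  by exists (v', r').
pose s := fix s k := if k is k'.+1 then f (k', s k') else ((fun=> t), 1 : R).
have s_ok k : ok (s k).
  by elim: k => [|k IH]; [split=> //=; exact: ltr01|have [] := fP (k, s k) IH].
have s_next k : next k (s k) (s k.+1) by have [] := fP (k, s k) (s_ok k).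
have r_small k : (s k).2 <= (2^-1) ^+ k.
  elim: k => [|k IH] //; have [_ h _] := s_next k; apply: le_trans h _.
  by rewrite exprSr ler_wpM2r // invr_ge0.
have r_decr k l : (k <= l)%N -> (s l).2 <= (s k).2.
  elim: l => [|l IH]; first by rewrite leqn0 => /eqP->.
  rewrite leq_eqVlt => /predU1P[->//|/IH]; apply: le_trans.
  have [_ h _] := s_next l; apply: le_trans h _.
  by rewrite ler_pdivrMr // ler_pMr ?ler1n //; case: (s_ok l).
have /choice[w wP] : forall i, exists l, forall e : R, 0 < e ->
    exists N, forall k, (N <= k)%N -> absv (l - (s k).1 i) < e.
  move=> i; apply: seq_complete => e e00.
  have [N Ne] : exists N, (2^-1 : R) ^+ N < e.
    by apply: exprn_lt_small; rewrite // invr_ge0 ler0n invf_lt1 ?ltr1n ?ltr0n.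
  exists N => k Nk; rewrite absvB; have [h _ _] := s_next k; apply: lt_trans (h i) _.
  by apply: le_lt_trans Ne; apply: le_trans (r_decr _ _ Nk) (r_small N).
(* By the ultrametric inequality the limit stays in every ball of the construction. *)
have s_lim k i : absv ((s k).1 i - w i) < (s k).2.
  have [N NP] := wP i _ (proj1 (s_ok k)).
  apply: (absv_lt_trans (y := (s (maxn N k)).1 i)); last by rewrite absvB NP // leq_maxl.
  elim: (maxn N k) (leq_maxr N k) => [|l IH].
    by rewrite leqn0 => /eqP->; rewrite subrr absv0; case: (s_ok 0%N).
  rewrite leq_eqVlt => /predU1P[<-|kl]; first by rewrite subrr absv0; case: (s_ok k).
  apply: (absv_lt_trans (y := (s l).1 i)); first exact: IH.
  by have [h _ _] := s_next l; exact: (lt_le_trans (h i) (r_decr k l kl)).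
exists w => _ [m _ <-] e e00.
have [l le_] : exists l, (2^-1 : R) ^+ l < e.
  by apply: exprn_lt_small; rewrite // invr_ge0 ler0n invf_lt1 ?ltr1n ?ltr0n.
have [_ _ /(_ w)] := s_next (pickle (m, l)).
rewrite /ey pickleK /= => -[i _|a Ba ya]; first exact: (s_lim (pickle (m, l)).+1).
by exists a => //; exact: lt_trans le_.
Qed.

(** Zero is replaced by [t], and an element of absolute value at least 1 by its quotient [t / y m],
    from which it is recovered because [t] is itself the term [u 0]. *)
Lemma generic_generators (t : F) (y : nat -> F) : 0 < absv t < 1 ->
  exists w : nat -> F, range (j \o y) `<=` ac (B `|` (j \o w) @` `I_n).
Proof.
move=> /[dup] t01 /andP[t0 t1].
pose u m := if m is m'.+1 then
  if y m' == 0 then t else if absv (y m') < 1 then y m' else t / y m' else t.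
have u01 m : 0 < absv (u m) < 1.
  case: m => //= m; have [//|y0] := eqVneq (y m) 0; have [y1|y1] := ltP (absv (y m)) 1.
    by rewrite absv_gt0 y0.
  rewrite absvM absvV divr_gt0 ?absv_gt0 //= -?absv_gt0 //.
  by rewrite ltr_pdivrMr ?absv_gt0 // mul1r (lt_le_trans t1).
have [w wu] := generic_sequence t01 u01; exists w => _ [m _ <-] /=.
have sA := ac_subfield (B `|` (j \o w) @` `I_n).
have Au k : ac (B `|` (j \o w) @` `I_n) (j (u k)) by apply: wu; exists k.
have := Au m.+1; rewrite /=; have [->|y0] := eqVneq (y m) 0; first by rewrite rmorph0 => _; exact: subfield0.
have [//|_ Aty] := ltP (absv (y m)) 1; have -> : y m = t / (t / y m) by rewrite invf_div mulrC divfK // -absv_gt0.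
rewrite rmorphM fmorphV; apply: (subfieldM sA); first exact: (Au 0%N).
exact: (subfieldV sA).
Qed.

End Genericity.

(** * Trivially valued fields *)

Section TrivialValuation.
Variables (R : realType) (W : valuedFieldType R).
Implicit Types (A B : set W) (p : {poly W}).

Lemma trivial_absv A x : subfield A -> (forall a, A a -> absv a <= 1) -> A x ->
  x != 0 -> absv x = 1.
Proof.
move=> sA A1 Ax x0; apply/eqP; rewrite eq_le A1 //=.
have := A1 _ (subfieldV sA Ax).
by rewrite absvV invf_le1 // absv_gt0.
Qed.

(** If [absv x > 1], the leading term of a monic equation with coefficients of absolute value at
    most 1 dominates all others. *)
Lemma trivial_alg A : subfield A -> (forall a, A a -> absv a <= 1) ->
  forall x, alg A x -> absv x <= 1.
Proof.
move=> sA A1 x /(alg_monic sA)[p [pm pA px]].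
rewrite leNgt; apply/negP => x1; have x0 : 0 < absv x by exact: lt_trans x1.
have sp : (1 < size p)%N by apply: root_size_gt1 px; exact: monic_neq0.
have spE : size p = (size p).-2.+2 by case: (size p) sp => [|[]].
have := rootP px; rewrite horner_coef spE big_ord_recr /= => /eqP.
rewrite addrC addr_eq0 -[X in p`_X]/(_.+2.-1) -spE -/(lead_coef p) (monicP pm) mul1r => /eqP xE.
have : absv (x ^+ (size p).-2.+1) <= absv x ^+ (size p).-2.
  rewrite xE absvN; apply: absv_sum_le => [|i _]; first by rewrite exprn_ge0 // ltW.
  rewrite absvM absvX; apply: (@le_trans _ _ (absv x ^+ i)).
    by rewrite ler_piMl ?exprn_ge0 ?absv_ge0 // A1.
  by rewrite ler_weXn2l ?(ltW x1) // -ltnS.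
by rewrite absvX exprS ger_pMl ?exprn_gt0 // leNgt x1.
Qed.

(** Reduction of the coefficients modulo elements of absolute value below 1, with [A'] as field of
    representatives. A nonzero [p] stays nonzero because its leading coefficient has absolute value
    1. *)
Lemma reduce_poly A A' p : subfield A -> subfield A' ->
  (forall a, A' a -> absv a <= 1) ->
  (forall a, A a -> exists2 b, A' b & absv (a - b) < 1) -> over A p ->
  exists q, [/\ over A' q, p != 0 -> q != 0 &
    forall x y, absv y <= 1 -> absv (x - y) < 1 -> absv (p.[x] - q.[y]) < 1].
Proof.
move=> sA sA' A'1 AA' pA.
have A1 a : A a -> absv a <= 1.
  move=> /AA'[b /A'1 b1 ab]; rewrite -(subrK b a); apply: absv_le => //; exact: ltW.
have /choice[c cP] : forall i, exists b, A' b /\ absv (p`_i - b) < 1.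
  by move=> i; have [b] := AA' _ (pA i); exists b.
exists (\poly_(i < size p) c i); split.
- move=> i; rewrite coef_poly; case: ifP => _; first by case: (cP i).
  exact: subfield0.
- move=> p0; have l1 : absv (lead_coef p) = 1.
    by apply: (trivial_absv sA A1); [exact: pA|rewrite lead_coef_eq0].
  have sp : (0 < size p)%N by rewrite size_poly_gt0.
  apply/eqP => /polyP/(_ (size p).-1); rewrite coef_poly coef0 prednK // leqnn => c0.
  by have [_] := cP (size p).-1; rewrite c0 subr0 -/(lead_coef p) l1 ltxx.
- move=> x y y1 xy; have x1 : absv x <= 1.
    by rewrite -(subrK y x); apply: absv_le => //; exact: ltW.
  rewrite horner_coef horner_poly -sumrB; apply: absv_sum_lt => // i _.
  have -> : p`_i * x ^+ i - c i * y ^+ i = (p`_i - c i) * x ^+ i + c i * (x ^+ i - y ^+ i) by ring.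
  have [A'c pc] := cP i; apply: absv_lt; rewrite absvM.
    by apply: le_lt_trans pc; rewrite absvX ler_piMr ?absv_ge0 // exprn_ile1 ?absv_ge0.
  apply: le_lt_trans xy; rewrite -[leRHS]mul1r ler_pM ?absv_ge0 ?A'1 //.
  rewrite subrXX absvM ler_piMr ?absv_ge0 //; apply: absv_sum_le => // k _.
  by rewrite absvM !absvX mulr_ile1 ?exprn_ge0 ?exprn_ile1 ?absv_ge0.
Qed.

Variables (F : valuedFieldType R) (j : {rmorphism F -> W}).
Hypotheses (jabs : absv_preserving j) (Ftriv : forall x : F, absv x <= 1).
Variables (B : set W) (xs : seq W).
Hypotheses (sB : subfield B) (BF : B `<=` range j).
Hypothesis jac : range j `<=` ac (B `|` lset xs).

Let cl_le1 (y : nat -> F) k a : cl (B `|` (j \o y) @` `I_k) a -> absv a <= 1.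
Proof.
apply: trivial_alg; first exact: gen_subfield.
have sF : subfield (range j).
  split; first by exists 1; rewrite ?rmorph1.
    by move=> _ _ [x _ <-] [z _ <-]; exists (x - z); rewrite ?rmorphB.
  by move=> _ _ [x _ <-] [z _ <-]; exists (x / z); rewrite ?fmorph_div.
move=> x /(gen_min sF) [|z _ <-]; last by rewrite jabs.
by move=> z [/BF//|[i _ <-]]; exists (y i).
Qed.

Let independent (y : nat -> F) k :=
  forall i, (i < k)%N -> ~ cl (B `|` (j \o y) @` `I_i) (j (y i)).

(* If the [j (y i)] are independent over [B], then the field generated by the
   [x i], which reduce to them, is also trivially valued. *)
Lemma gen_reduce (y : nat -> F) (x : nat -> W) k : independent y k ->
  (forall i, absv (x i - j (y i)) < 1) ->
  forall a, gen (B `|` x @` `I_k) a ->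
    exists2 b, cl (B `|` (j \o y) @` `I_k) b & absv (a - b) < 1.
Proof.
move=> + xy; elim: k => [|k IH] ind a Aa.
  exists a; last by rewrite subrr absv0.
  apply: gen_cl; apply: gen_mono Aa => z [Bz|[i]]; first by left.
  by rewrite /= ltn0.
have {}IH := IH (fun i ik => ind i (ltnW ik)).
have sA := gen_subfield (B `|` x @` `I_k); have sA' := cl_subfield (B `|` (j \o y) @` `I_k).
have A'A' : cl (B `|` (j \o y) @` `I_k) `<=` cl (B `|` (j \o y) @` `I_k.+1).
  by apply: cl_mono => z [Bz|[i ik <-]]; [left|right; exists i => //; exact: ltnW].
have y1 : absv (j (y k)) <= 1 by rewrite jabs.
have A'y : cl (B `|` (j \o y) @` `I_k.+1) (j (y k)).
  by apply: cl_incl; right; exists k => /=.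
have A'h (q : {poly W}) : over (cl (B `|` (j \o y) @` `I_k)) q -> cl (B `|` (j \o y) @` `I_k.+1) q.[j (y k)].
  move=> qA; apply: (@subring_horner _ (cl (B `|` (j \o y) @` `I_k.+1))) => //.
    exact/subfield_subring/cl_subfield.
  by move=> i; exact/A'A'/qA.
have {Aa} : gen (gen (B `|` x @` `I_k) `|` [set x k]) a.
  apply: gen_mono Aa => z [Bz|[i ik <-]]; first by left; apply: gen_incl; left.
  have [ik'|ki] := ltnP i k; first by left; apply: gen_incl; right; exists i.
  by right; congr x; apply/eqP; rewrite eqn_leq ki -ltnS ik.
move=> /(gen_adjoin sA)[_ [_ [[p pA <-] [q qA <-] q0 ->]]].
have [p' [p'A' _ pp']] := reduce_poly sA sA' (@cl_le1 y k) IH pA.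
have [q' [q'A' q'0 qq']] := reduce_poly sA sA' (@cl_le1 y k) IH qA.
have {}pp' := pp' _ _ y1 (xy k); have {}qq' := qq' _ _ y1 (xy k).
(* Independence of [j (y k)] keeps the reduced denominator from vanishing. *)
have {}q'0 : q'.[j (y k)] != 0.
  apply/eqP => q'y; apply: (ind k (ltnSn k)); apply: cl_alg.
  exists q'; split=> //; last exact/rootP.
  by apply: q'0; apply: contraNneq q0 => ->; rewrite horner0.
have q'1 : absv q'.[j (y k)] = 1.
  by apply: (trivial_absv (cl_subfield _) (@cl_le1 y k.+1)) => //; exact: A'h.
have q1 : absv q.[x k] = 1.
  by rewrite -(subrK q'.[j (y k)] q.[x k]) addrC absv_eql q'1.
exists (p'.[j (y k)] / q'.[j (y k)]).
  have [_ _ AV] := cl_subfield (B `|` (j \o y) @` `I_k.+1).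
  by apply: AV; exact: A'h.
have -> : p.[x k] / q.[x k] - p'.[j (y k)] / q'.[j (y k)] =
  ((p.[x k] - p'.[j (y k)]) * q'.[j (y k)] - p'.[j (y k)] * (q.[x k] - q'.[j (y k)])) / (q.[x k] * q'.[j (y k)]).
  by field; rewrite q0 q'0.
rewrite absvM absvV absvM q1 q'1 mulr1 divr1; apply: absv_ltB; rewrite absvM ?q'1 ?mulr1 //.
apply: le_lt_trans qq'; rewrite ler_piMl ?absv_ge0 //.
by apply: (@cl_le1 y k.+1); exact: A'h.
Qed.

(** Approximants [x i] of the [j (y i)], algebraic over [B] and [xs], are independent too, since an
    equation for [x i] would reduce to one for [j (y i)]; [steinitz] bounds their number. *)
Lemma trivial_independent (y : nat -> F) k : independent y k -> (k <= size xs)%N.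
Proof.
move=> ind; have /choice[x xP] : forall i, exists x, cl (B `|` lset xs) x /\ absv (x - j (y i)) < 1.
  move=> i; have ji : range j (j (y i)) by exists (y i).
  have [x cx yx] := jac ji ltr01.
  by exists x; rewrite absvB.
have xy i : absv (x i - j (y i)) < 1 by case: (xP i).
rewrite -(size_mkseq x k); apply: (steinitz (S := B)) => [z /mapP[i _ ->]|i].
  by have [] := xP i.
rewrite size_mkseq => ik; rewrite nth_mkseq // => ci.
have {ci} [p [p0 pA px]] : cl (B `|` x @` `I_i) (x i).
  apply: cl_mono ci => z [Bz|zt]; [by left|right].
  have it : size (take i (mkseq x k)) = i by rewrite size_takel // size_mkseq ltnW.
  have [l] := nthP 0 zt; rewrite it => li <-; exists l => //.
  by rewrite nth_take // nth_mkseq // (ltn_trans li).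
have indi : independent y i by move=> l li; apply: ind; exact: ltn_trans ik.
have [q [qA /(_ p0) q0 pq]] := reduce_poly (gen_subfield _) (cl_subfield _)
  (@cl_le1 y i) (gen_reduce indi xy) pA.
have {pq} := pq (x i) (j (y i)); rewrite jabs (rootP px) sub0r absvN => /(_ (Ftriv _) (xy i)) qy.
apply: (ind i ik); apply: cl_alg; exists q; split=> //; apply: contraTT qy => qy0.
rewrite (trivial_absv (cl_subfield (B `|` (j \o y) @` `I_i.+1)) (@cl_le1 y i.+1)) ?ltxx //.
apply: subring_horner; first exact/subfield_subring/cl_subfield.
  move=> l; apply: cl_mono (qA l) => z [Bz|[a ai <-]]; first by left.
  by right; exists a => //; exact: ltnW.
by apply: cl_incl; right; exists i => /=.
Qed.

Lemma trivial_generators : exists m (w : nat -> F), (m <= size xs)%N /\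
  range j `<=` cl (B `|` (j \o w) @` `I_m).
Proof.
(* A maximal independent tuple exists by the bound [size xs] on the length. *)
have [m [w [wind wmax]]] : exists m (w : nat -> F), independent w m /\
    forall w', ~ independent w' m.+1.
  apply: contrapT => nm; suff ind k : exists w, independent w k.
    by have [w /trivial_independent] := ind (size xs).+1; rewrite ltnn.
  elim: k => [|k [w wk]]; first by exists (fun=> 0).
  by apply: contrapT => nk; apply: nm; exists k, w; split=> // w' w'k; apply: nk; exists w'.
exists m, w; split=> [|_ [f _ <-]]; first exact: trivial_independent wind.
apply: contrapT => nf; pose w' i := if (i < m)%N then w i else f.
apply: (wmax w') => i; rewrite ltnS => im.
have -> : (j \o w') @` `I_i = (j \o w) @` `I_i.
  by apply: eq_imagel => k /= ki; rewrite /w' (leq_trans ki im).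
rewrite /w'; have [im'|mi] := ltnP i m; first exact: wind.
by have -> : i = m by apply/eqP; rewrite eqn_leq im.
Qed.

End TrivialValuation.

(** * Independence of the completed closure *)

Lemma gen_image (F W : fieldType) (j : {rmorphism F -> W}) (T : set F) :
  gen (j @` T) = j @` gen T.
Proof.
have sT := gen_subfield T; apply/seteqP; split.
  apply: gen_min; last by move=> _ [x Tx <-]; exists x => //; exact: gen_incl.
  split; first by exists 1; [have [] := sT|rewrite rmorph1].
    by move=> _ _ [x Tx <-] [y Ty <-]; exists (x - y); [exact: (subfieldB sT)|rewrite rmorphB].
  by move=> _ _ [x Tx <-] [y Ty <-]; exists (x / y); [have [_ _ AV] := sT; exact: AV|rewrite fmorph_div].
move=> _ [x + <-]; have sj := gen_subfield (j @` T).
apply: (@gen_min _ _ (j @^-1` gen (j @` T))).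
  split; rewrite /preimage /=.
  - by rewrite rmorph1; have [] := sj.
  - by move=> y z jy jz; rewrite rmorphB; exact: (subfieldB sj).
  - by move=> y z jy jz; rewrite fmorph_div; have [_ _ AV] := sj; exact: AV.
by move=> y Ty; apply: gen_incl; exists y.
Qed.

Lemma over_gen_image (F W : fieldType) (j : {rmorphism F -> W}) (T : set F) (p : {poly W}) :
  over (gen (j @` T)) p <-> exists2 q, over (gen T) q & p = map_poly j q.
Proof.
rewrite gen_image; split=> [pA|[q qT -> i]]; last by rewrite coef_map; exists q`_i.
have /choice[c cP] : forall i, exists c, gen T c /\ j c = p`_i.
  by move=> i; have [c] := pA i; exists c.
exists (\poly_(i < size p) c i).
  move=> i; rewrite coef_poly; case: ifP => _; first by case: (cP i).
  by apply: subfield0; exact: gen_subfield.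
apply/polyP => i; rewrite coef_map coef_poly.
case: ltnP => [_|ip]; first by case: (cP i).
by rewrite ?rmorph0 nth_default //= rmorph0.
Qed.

Section Transfer.
Variables (R : realType) (F V W : valuedFieldType R).
Variables (j : {rmorphism F -> V}) (k : {rmorphism F -> W}).
Hypotheses (jabs : absv_preserving j) (kabs : absv_preserving k).
Hypothesis cW : GRing.closed_field_axiom W.

(* By [newton_coef] and [newton_root], approximability is a condition on the
   Taylor coefficients at [f] of polynomials over the field generated by [T]. *)
Lemma ac_transfer (T : set F) f : ac (j @` T) (j f) -> ac (k @` T) (k f).
Proof.
move=> jf e e0; have [b [p [p0 pT pb]] fb] := jf e e0.
have [q qT pq] := (over_gen_image j T p).1 pT.
pose u := q \Po ('X + f%:P).
have uE (U : fieldType) (h : {rmorphism F -> U}) : map_poly h u = map_poly h q \Po ('X + (h f)%:P).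
  by rewrite map_comp_poly rmorphD /= map_polyX map_polyC.
have u0 : u != 0.
  apply: contraNneq p0 => u0; rewrite pq map_poly_eq0; apply/eqP.
  have -> : q = u \Po ('X - f%:P).
    by rewrite /u -comp_polyA comp_polyD comp_polyX comp_polyC subrK comp_polyXr.
  by rewrite u0 comp_poly0.
have [i i0] : exists2 i, (0 < i)%N & absv (map_poly j u)`_0 < absv (map_poly j u)`_i * e ^+ i.
  apply: (newton_coef (r := b - j f)); first by rewrite map_poly_eq0.
    by rewrite uE -pq /root horner_comp !hornerE subrK.
  by rewrite absvB.
rewrite !coef_map !jabs -!kabs => ui.
have [r ur re] : exists2 r, root (map_poly k u) r & absv r < e.
  by apply: (newton_root cW i0 e0); rewrite !coef_map.
exists (r + k f); last by rewrite opprD addrCA subrr addr0 absvN.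
exists (map_poly k q); split.
- apply: contraNneq u0 => q0; rewrite -(map_poly_eq0 k) uE q0 comp_poly0 //.
- by apply/over_gen_image; exists q.
- by move: ur; rewrite uE /root horner_comp !hornerE.
Qed.

End Transfer.

(** * T.a. generation in terms of [ac] *)

Lemma adjoin_setE (R : realType) (K L : analyticFieldType R) (i : K -> L) (S : set L) :
  adjoin_set i S = gen (range i `|` S).
Proof.
by apply/seteqP; split=> x Sx A [/= Acl AS]; apply: Sx; split=> //; exact/subfieldE.
Qed.

Lemma polyOver_over (F : fieldType) (A : set F) (p : {poly F}) : A 0 ->
  p \is a polyOver [in A] <-> over A p.
Proof.
move=> A0; split=> [/allP pA i|pA].
  have [ip|ip] := ltnP i (size p); last by rewrite nth_default.
  by have := pA _ (mem_nth 0 ip); rewrite inE.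
by apply/allP => a /(nthP 0)[i _ <-]; rewrite inE; exact: pA.
Qed.

Section Generating.
Variables (R : realType) (K L : analyticFieldType R) (i : K -> L).
Variable CL : completedClosure L.

Let W := cc_alg CL.
Let j : {rmorphism L -> W} := @cc_in _ _ CL.
Let m : {rmorphism W -> CL} := @cc_map _ _ CL.
Let cW : GRing.closed_field_axiom W := @cc_alg_closed _ _ CL.

(** A polynomial over [L] already splits in [W], so its roots in the completion come from [W]. *)
Lemma alg_closure_adjoinE (S : set L) :
  @alg_closure_adjoin _ _ _ i CL S = m @` cl (j @` (range i `|` S)).
Proof.
have g0 : gen (range i `|` S) 0 by apply: subfield0; exact: gen_subfield.
have embE (p : {poly L}) : map_poly (cc_embed CL) p = map_poly m (map_poly j p).
  by rewrite -map_poly_comp.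
apply/seteqP; split=> [x [p []]|_ [x [p [p0 pT px]] <-]].
  rewrite adjoin_setE => p0 /(polyOver_over _ g0) pS.
  rewrite embE => px.
  have jp0 : map_poly j p != 0 by rewrite map_poly_eq0.
  have [rs jp] := closed_field_split cW jp0.
  have : x \in map m rs.
    move: px; rewrite jp map_polyZ rootZ; last by rewrite fmorph_eq0 lead_coef_eq0.
    rewrite rmorph_prod /=; under eq_bigr do rewrite map_polyXsubC.
    by rewrite -(big_map m xpredT (fun r => 'X - r%:P)) root_prod_XsubC.
  move=> /mapP[r rrs ->]; exists r => //; exists (map_poly j p); split=> //.
    by apply/over_gen_image; exists p.
  by rewrite jp rootZ ?lead_coef_eq0 // root_prod_XsubC.
have [q qT pq] := (over_gen_image j _ p).1 pT.
exists q; split; first by apply: contraNneq p0 => q0; rewrite pq q0 rmorph0.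
  by rewrite adjoin_setE; apply/polyOver_over.
by rewrite embE -pq /root horner_map (rootP px) rmorph0.
Qed.

(** If the elements of [L] can be approximated, then by [ac_alg] so can those of its algebraic
    closure [W], which is dense in the completion. *)
Lemma ta_generatingE (S : set L) :
  ta_generating i CL S <-> range j `<=` ac (j @` (range i `|` S)).
Proof.
have mabs : absv_preserving m := @cc_map_absv _ _ CL.
rewrite /ta_generating alg_closure_adjoinE; split=> [clT _ [f _ <-] e e0|jS].
  have : closure (m @` cl (j @` (range i `|` S))) (m (j f)) by rewrite clT.
  move=> /(_ _ (nbhsx_ballx (m (j f)) e e0))[_ [[a Sa <-]]].
  by rewrite ball_absvE /= -rmorphB mabs; exists a.
have Wac x : ac (j @` (range i `|` S)) x.
  apply: (ac_alg cW); have [p p0 px] := @cc_in_algebraic _ _ CL x.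
  exists (map_poly j p); split=> //; first by rewrite map_poly_eq0.
  by move=> l; rewrite coef_map; apply: jS; exists p`_l.
apply/seteqP; split=> // x _ U /nbhs_ballP[e /= e0 eU].
have [|y [xy [z _ zy]]] := @cc_map_dense _ _ CL (interior (ball x e)) _ (open_interior _).
  exists x; exact: nbhsx_ballx.
have [a Sa za] := Wac z e e0; exists (m a); split; first by exists a.
apply: eU; have := interior_subset xy; rewrite !ball_absvE /= -zy => xz.
by apply: absv_lt_trans xz _; rewrite -rmorphB mabs.
Qed.

End Generating.

(** * Conclusion from the trivially and nontrivially valued cases *)

Lemma nontrivially_valuedP (R : realType) (F : valuedFieldType R) :
  (exists t : F, 0 < absv t < 1) \/ (forall x : F, absv x <= 1).
Proof.
have [|nt] := pselect (exists t : F, 0 < absv t < 1); first by left.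
right=> x; rewrite leNgt; apply/negP => x1; apply: nt; exists x^-1.
by rewrite absvV invr_gt0 invf_lt1 ?x1 ?andbT; exact: lt_trans x1.
Qed.

(** In the nontrivially valued case [countably_generated] reduces the approximation of all of [F] to
    that of countably many elements, which [generic_generators] handles. *)
Lemma finitely_generated (R : realType) (F : analyticFieldType R) (W : valuedFieldType R)
    (j : {rmorphism F -> W}) (S : set F) (xs : seq W) :
  GRing.closed_field_axiom W -> absv_preserving j -> subfield S ->
  range j `<=` ac (j @` S `|` lset xs) ->
  exists n (w : nat -> F), (n <= size xs)%N /\
    range j `<=` ac (j @` (S `|` w @` `I_n)).
Proof.
move=> cW jabs sS jac; have sB : subfield (j @` S).
  have <- : gen (j @` S) = j @` S by rewrite gen_image /gen smallest_id.
  exact: gen_subfield.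
have BF : j @` S `<=` range j by move=> _ [x _ <-]; exists x.
have imE n (w : nat -> F) : j @` (S `|` w @` `I_n) = j @` S `|` (j \o w) @` `I_n.
  by rewrite image_setU image_comp.
have [[t t01]|triv] := nontrivially_valuedP F; last first.
  have [n [w [nxs jw]]] := trivial_generators jabs triv BF jac.
  by exists n, w; split=> //; rewrite imE => x /jw; exact: cl_ac.
have xsE : lset xs = nth 0 xs @` `I_(size xs).
  apply/seteqP; split=> [x /(nthP 0)[l lx <-]|_ [l lx <-]]; first by exists l.
  exact: mem_nth.
have sF : subfield (range j).
  have <- : gen (range j) = range j.
    by rewrite gen_image /gen smallest_id.
  exact: gen_subfield.
have jt01 : 0 < absv (j t) < 1 by rewrite jabs.
have Mt : range j (j t) by exists t.
have jac' := jac; rewrite xsE in jac'.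
have [y yF jy] := countably_generated cW sF BF Mt jt01 jac'.
have /choice[y' y'P] : forall l, exists x, j x = y l.
  by move=> l; have [x _ <-] := yF l; exists x.
have [w jw] := generic_generators cW jabs sB jac y' t01.
exists (size xs), w; split=> //; rewrite imE => x /jy; apply: (ac_sub cW) => z [Sz|[l _ <-]].
  by apply: ac_incl; left.
by rewrite -y'P; apply: jw; exists l.
Qed.

Theorem theorem2p3p2 (R : realType) (K E F L : analyticFieldType R)
    (iKE : {rmorphism K -> E}) (iEF : {rmorphism E -> F})
    (iFL : {rmorphism F -> L})
    (hKE : absv_preserving iKE) (hEF : absv_preserving iEF)
    (hFL : absv_preserving iFL)
    (CF : completedClosure F) (CL : completedClosure L) :
  small (iFL \o iEF \o iKE) CL ->
  Trc iEF CF #<= Trc (iFL \o iEF \o iKE) CL /\ small iEF CF.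
Proof.
set i := iFL \o iEF \o iKE => smallL.
suff TF : Trc iEF CF #<= Trc i CL.
  by split=> //; exact: card_le_finite TF smallL.
have [genL _] := TrcP i CL.
(* Without repetitions, [size s] is the cardinality of the chosen generating set. *)
have /finite_seqP[s0 Trc0] := smallL; pose s := undup s0.
have TrcE : Trc i CL = [set` s].
  by rewrite Trc0; apply/seteqP; split=> x /=; rewrite mem_undup.
pose cin : {rmorphism L -> cc_alg CL} := @cc_in _ _ CL.
pose j : {rmorphism F -> cc_alg CL} := [the {rmorphism F -> cc_alg CL} of cin \o iFL].
have cW : GRing.closed_field_axiom (cc_alg CL) := @cc_alg_closed _ _ CL.
have jabs : absv_preserving j by move=> x; rewrite /= cc_in_absv hFL.
pose xs := map cin s.
have sE : subfield (range iEF).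
  have <- : gen (range iEF) = range iEF.
    by rewrite gen_image /gen smallest_id.
  exact: gen_subfield.
(* [E] contains the image of [K], so the generators of [L] over [K] also serve over [E]. *)
have jac : range j `<=` ac (j @` range iEF `|` lset xs).
  move=> _ [f _ <-]; have := (ta_generatingE i CL (Trc i CL)).1 genL (j f).
  move=> /(_ (ex_intro2 _ _ (iFL f) I erefl)); apply: ac_mono => _ [x [[a _ <-]|xS] <-].
    by left; exists (iEF (iKE a)).
  by right; rewrite /lset /= map_f //; move: xS; rewrite TrcE.
have [n [w [ns jw]]] := finitely_generated cW jabs sE jac.
pose T := w @` `I_n.
have genT : ta_generating iEF CF T.
  apply/ta_generatingE => _ [f _ <-].
  (* The approximations were found in the algebraic closure of [L]; they are carried over to the
     given one of [F]. *)
  apply: (ac_transfer jabs (@cc_in_absv _ _ CF) (@cc_alg_closed _ _ CF)).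
  by apply: jw; exists f.
have [_ /(_ T genT) TrcT] := TrcP iEF CF.
apply: (card_le_trans TrcT); apply: (card_le_trans (card_image_le _ _)).
apply: (@card_le_trans _ _ _ `I_(size s)); first by rewrite card_le_II; move: ns; rewrite size_map.
have -> : Trc i CL = nth 0 s @` `I_(size s).
  rewrite TrcE; apply/seteqP; split=> [x /(nthP 0)[l ls <-]|_ [l ls <-]]; first by exists l.
  exact: mem_nth.
have /inj_card_eq : {in `I_(size s) &, injective (nth 0 s)}.
  by move=> a b /set_mem al /set_mem bl /eqP; rewrite nth_uniq ?undup_uniq // => /eqP.
by rewrite card_eq_sym => /card_eqPle[].
Qed.
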